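(* Let $1\le m\le n-1$ be integers and let $E\subset\mathbb{R}^n$ be a Borel set. Then for all $V\in G(n,m)$ $$\dim_{\rm P}\pi_VE\le\dim_{\rm P}^{\,m}E,$$ and for $\gamma_{n,m}$-almost all $V\in G(n,m)$ $$\dim_{\rm P}\pi_VE\ge\dim_{\rm P}^{\,m}E.$$
   Context: $G(n,m)$ is the Grassmannian of $m$-dimensional linear subspaces of $\mathbb{R}^n$, $\gamma_{n,m}$ is the invariant (under the orthogonal group) Borel probability measure on $G(n,m)$, and $\pi_V:\mathbb{R}^n\to V$ is orthogonal projection. For $s>0$ and $r>0$ let $\phi_r^s(x)=\min\{1,(r/|x|)^s\}$ for $x\in\mathbb{R}^n$ (with $\phi_r^s(0)=1$). For non-empty compact $F\subset\mathbb{R}^n$ let $\mathcal{M}(F)$ be the set of Borel probability measures supported by $F$, and define the capacity $C_r^s(F)$ by $$\frac{1}{C_r^s(F)}=\inf_{\mu\in\mathcal{M}(F)}\int\int\phi_r^s(x-y)\,d\mu(x)\,d\mu(y).$$ The upper $s$-box dimension profile of $F$ is $\overline{\dim}_{\rm B}^{\,s}F=\limsup_{r\to0}\frac{\log C_r^s(F)}{-\log r}$. The upper box-counting dimension of a non-empty compact set $F$ in a Euclidean space is $\overline{\dim}_{\rm B}F=\limsup_{r\to0}\frac{\log N_r(F)}{-\log r}$, where $N_r(F)$ is the minimum number of sets of diameter $r$ that can cover $F$. The packing dimension of a set $E$ in a Euclidean space is $$\dim_{\rm P}E=\inf\Big\{\sup_{1\le i<\infty}\overline{\dim}_{\rm B}E_i:\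 E\subset\bigcup_{i=1}^\infty E_i,\ \text{each } E_i \text{ non-empty and compact}\Big\},$$ and for $s>0$ the packing dimension profile of $E\subset\mathbb{R}^n$ is $$\dim_{\rm P}^{\,s}E=\inf\Big\{\sup_{1\le i<\infty}\overline{\dim}_{\rm B}^{\,s}E_i:\ E\subset\bigcup_{i=1}^\infty E_i,\ \text{each } E_i \text{ non-empty and compact}\Big\}.$$ *)

(* Defs.v *)
From HB Require Import structures.
From mathcomp Require Import all_boot all_order all_algebra.
From mathcomp Require Import all_classical all_reals all_analysis.

Set Implicit Arguments.
Unset Strict Implicit.
Unset Printing Implicit Defensive.

Import Order.TTheory GRing.Theory Num.Theory.
Import numFieldNormedType.Exports.

Local Open Scope classical_set_scope.
Local Open Scope ring_scope.

Notation borelType T := (g_sigma_algebraType (@open T)).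

Section EuclideanSpace.
Context {R : realType} {n : nat}.
Implicit Types (x y : 'rV[R]_n) (A F E : set 'rV[R]_n) (s r : R).

Definition dotv x y : R := \sum_(i < n) x 0 i * y 0 i.

(* The library norm on ['rV[R]_n] is the sup norm; it induces the same topology
   and the same Borel sets. *)
Definition enorm x : R := Num.sqrt (dotv x x).

Definition orthproj (V : {vspace 'rV[R]_n}) x : 'rV[R]_n :=
  xget 0 [set y | y \in V /\ forall z, z \in V -> dotv (x - y) z = 0].

Lemma orthprojP (V : {vspace 'rV[R]_n}) x :
  orthproj V x \in V /\
  forall z, z \in V -> dotv (x - orthproj V x) z = 0.
Proof.
rewrite /orthproj; case: xgetP => [y -> //|H]; exfalso.
pose B : 'M[R]_(\dim V, n) := \matrix_i (vbasis V)`_i.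
have BV (u : 'rV[R]_(\dim V)) : u *m B \in V.
  rewrite mulmx_sum_row; apply: rpred_sum => i _; rewrite rowK rpredZ// vbasis_mem// memt_nth//.
have VB z : z \in V -> exists u, z = u *m B.
  move=> zV; exists (\row_i coord (vbasis V) i z).
  rewrite mulmx_sum_row [LHS](coord_vbasis zV).
  by apply: eq_bigr => i _; rewrite rowK mxE.
have dE (a c : 'rV[R]_n) : dotv a c = (a *m c^T) 0 0.
  by rewrite mxE; apply: eq_bigr => i _; rewrite mxE.
have d0 (a : 'rV[R]_n) : dotv a a = 0 -> a = 0.
  move=> /eqP; rewrite psumr_eq0 => [/allP h|j _]; last by rewrite -expr2 sqr_ge0.
  by apply/rowP=> j; move: (h j (mem_index_enum _)) => /=; rewrite mxE mulf_eq0 orbb => /eqP.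
have rf (u : 'rV[R]_(\dim V)) : u *m B = 0 -> u = 0.
  move=> u0; have /freeP fr := basis_free (vbasisP V).
  apply/rowP=> i; rewrite [RHS]mxE; apply: (fr (fun i => u 0 i)); rewrite -[RHS]u0 mulmx_sum_row.
  by apply: eq_bigr=> j _; rewrite rowK.
have Gu : B *m B^T \in unitmx.
  rewrite -row_free_unit; apply/row_freeP.
  have : kermx (B *m B^T) = 0.
    apply/row_matrixP => i; rewrite row0; apply: rf; apply: d0.
    rewrite dE trmx_mul mulmxA -(mulmxA _ B) -row_mul mulmx_ker row0 mul0mx mxE//.
  move/eqP; rewrite kermx_eq0 => /row_freeP//.
apply: (H (x *m B^T *m invmx (B *m B^T) *m B)); split=> [|z /VB[u ->]]; first exact: BV.
rewrite dE trmx_mul mulmxA mulmxBl -(mulmxA _ B) mulmxKV//.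
by rewrite subrr mul0mx mxE.
Qed.

Definition diam A : \bar R :=
  ereal_sup [set (enorm (p.1 - p.2))%:E | p in A `*` A].

Definition covering_number r F : R :=
  inf [set k%:R | k in [set k : nat | exists A : 'I_k -> set 'rV[R]_n,
    (forall i, diam (A i) = r%:E) /\ F `<=` \bigcup_i A i]].

Definition upper_box_dim F : \bar R :=
  limf_esup (fun r => (ln (covering_number r F) / - ln r)%:E) 0^'+.

Definition phi s r x : R :=
  if x == 0 then 1 else Num.min 1 ((r / enorm x) `^ s).

Definition energy s r (mu : probability (borelType 'rV[R]_n) R) : \bar R :=
  (\int[mu]_y \int[mu]_x (phi s r ((x : 'rV[R]_n) - y))%:E)%E.

Definition capacity s r F : R :=
  (fine (ereal_inf [set energy s r mu | mu in
    [set mu : probability (borelType 'rV[R]_n) R | mu (~` F) = 0%E]]))^-1.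

Definition upper_box_dim_profile s F : \bar R :=
  limf_esup (fun r => (ln (capacity s r F) / - ln r)%:E) 0^'+.

Definition compact_cover E (F : nat -> set 'rV[R]_n) : Prop :=
  (forall i, F i !=set0 /\ compact (F i)) /\ E `<=` \bigcup_i F i.

Definition packing_dim E : \bar R :=
  ereal_inf [set ereal_sup (range (fun i => upper_box_dim (F i))) |
    F in compact_cover E].

Definition packing_dim_profile s E : \bar R :=
  ereal_inf [set ereal_sup (range (fun i => upper_box_dim_profile s (F i))) |
    F in compact_cover E].

End EuclideanSpace.

(* [le_mn] makes the type non-empty: measurable types are pointed in the
   library. *)
Record Grassmannian (R : realType) (n m : nat) (le_mn : (m <= n)%N) := Subspace {
  subspace :> {vspace 'rV[R]_n};
  dim_subspace : \dim subspace == m }.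
Arguments Grassmannian R {n m} le_mn.
Arguments Subspace {R n m} le_mn _ _.

Section Grassmannian.
Context {R : realType} {n m : nat} {le_mn : (m <= n)%N}.

Lemma grassmannian_point_subproof :
  \dim <<take m (vbasis {:'rV[R]_n})>> == m.
Proof.
have sz : size (take m (vbasis {:'rV[R]_n})) = m.
  by rewrite size_takel// size_tuple dimvf /dim/= mul1n.
rewrite -[X in _ == X]sz; move: (basis_free (vbasisP {:'rV[R]_n})).
by rewrite -{1}(cat_take_drop m (vbasis _)) => /catl_free.
Qed.

HB.instance Definition _ := [isSub for @subspace R n m le_mn].
HB.instance Definition _ := [Choice of Grassmannian R le_mn by <:].
HB.instance Definition _ := isPointed.Build (Grassmannian R le_mn)
  (Subspace le_mn _ grassmannian_point_subproof).

(* [V] is identified with the matrix of its orthogonal projection, so the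
   topology is that of the usual metric, the norm of the difference of the
   projections. *)
Definition projmx (V : Grassmannian R le_mn) : 'M[R]_n :=
  lin1_mx (orthproj V).

HB.instance Definition _ :=
  Topological.copy (Grassmannian R le_mn) (initial_topology projmx).

Definition orthogonal_image (A : 'M[R]_n) (B : set (Grassmannian R le_mn)) :
    set (Grassmannian R le_mn) :=
  [set W | exists2 V, B V & W = (linfun (mulmxr A) @: V)%VS :> {vspace 'rV[R]_n}].

Definition orthogonally_invariant
    (gamma : probability (borelType (Grassmannian R le_mn)) R) : Prop :=
  forall A : 'M[R]_n, A *m A^T = 1%:M ->
  forall B : set (Grassmannian R le_mn),
    (@open (Grassmannian R le_mn)).-sigma.-measurable B ->
    gamma (orthogonal_image A B) = gamma B.

End Grassmannian.

(* Main.v *)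
Require Import Defs.
From HB Require Import structures.
From mathcomp Require Import all_boot all_order all_algebra.
From mathcomp Require Import all_classical all_reals all_analysis.
From mathcomp Require Import measurable_realfun.
From mathcomp Require Import ring lra zify.

(** Upper bound, for every [V].  Covers of [E] by compact sets project to covers
    of its projection, so it is enough to compare the upper box dimension of the
    projection of a compact set [F] with the profile of [F].  Cut [V] into cells
    of side comparable to [r], choose one point of [F] above each of the [N]
    occupied cells and let each carry the mass [1 / N].  Since [V] has dimension
    [m], the number of cells in a dyadic shell grows exactly as fast as the kernel
    decays, so the energy of this measure is at most a constant times
    [- ln r / N].  Hence [N], and with it the covering number, is at most a
    constant times [- ln r] times the capacity
    ([covering_number_le_capacity]), and the logarithm disappears in the exponent
    ([upper_box_dim_orthproj_le]).

    Lower bound, for almost every [V].  For an invariant measure, the probability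
    that the projection of [x] has length at most [r] is at most a constant times
    the kernel at [x] ([slab_measure_le]).  Invariance reduces this to counting the
    points of a finite grid that lie in a slab around the orthogonal complement of
    one fixed subspace.  If the profile of a compact set [F] exceeds [t], then at
    arbitrarily small scales [r] there are finitely many weighted points of [F] of
    energy at most about [r ^ t] ([capacity_exponent_gt]).  Averaging over [V], the
    mass of the pairs of points with projections within [r] is for most [V] at most
    about [r ^ t], and by the Cauchy-Schwarz inequality the covering number of the
    projection is at least about [r ^ (- t)]
    ([ae_upper_box_dim_orthproj_ge]).

    The passage from compact sets to the Borel set [E] has to cope with the
    uncountably many covers of the projections.  A Borel set is the projection of a
    closed set [D] in the product of Euclidean space and the Baire space
    ([analytic_borel]).  Removing from [D] the neighbourhoods with small profile
    leaves a closed kernel each of whose nonempty open pieces has profile larger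
    than [t] ([profile_le_kernel]).  The product has a countable family of cells
    playing the role of a base, so almost every [V] is good for all of them at the
    same time.  For such [V] and any cover of the projection of [E] by compact
    sets, the Baire category theorem ([seq_closed_baire]) puts the projection of
    one of these pieces inside one set of the cover, whose upper box dimension is
    then at least [t] ([ae_packing_dim_orthproj_ge]). *)

Set Implicit Arguments.
Unset Strict Implicit.
Unset Printing Implicit Defensive.

Import Order.TTheory GRing.Theory Num.Theory.
Import numFieldNormedType.Exports.

Local Open Scope classical_set_scope.
Local Open Scope ring_scope.

(** * Euclidean norm and orthogonal projections *)

Section EuclideanNorm.
Context {R : realType} {n : nat}.
Implicit Types (x y z : 'rV[R]_n) (a : R).

Lemma dotvC x y : dotv x y = dotv y x.
Proof. by apply: eq_bigr => i _; rewrite mulrC. Qed.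

Lemma dotvDl x y z : dotv (x + y) z = dotv x z + dotv y z.
Proof. by rewrite -big_split; apply: eq_bigr => i _; rewrite mxE mulrDl. Qed.

Lemma dotvZl a x z : dotv (a *: x) z = a * dotv x z.
Proof. by rewrite mulr_sumr; apply: eq_bigr => i _; rewrite mxE mulrA. Qed.

Lemma dotvBl x y z : dotv (x - y) z = dotv x z - dotv y z.
Proof. by rewrite -[- y]scaleN1r dotvDl dotvZl mulN1r. Qed.

Lemma dotvDr x y z : dotv z (x + y) = dotv z x + dotv z y.
Proof. by rewrite dotvC dotvDl !(dotvC z). Qed.

Lemma dotvZr a x z : dotv z (a *: x) = a * dotv z x.
Proof. by rewrite dotvC dotvZl dotvC. Qed.

Lemma dotvBr x y z : dotv z (x - y) = dotv z x - dotv z y.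
Proof. by rewrite dotvC dotvBl !(dotvC z). Qed.

Lemma dotvE x y : dotv x y = (x *m y^T) 0 0.
Proof. by rewrite mxE; apply: eq_bigr => i _; rewrite mxE. Qed.

Lemma dotv_ge0 x : 0 <= dotv x x.
Proof. by apply: sumr_ge0 => i _; rewrite -expr2 sqr_ge0. Qed.

Lemma dotv_eq0 x : (dotv x x == 0) = (x == 0).
Proof.
apply/idP/eqP => [|->]; last by rewrite /dotv big1// => i _; rewrite mxE mul0r.
rewrite psumr_eq0 => [/allP h|j _]; last by rewrite -expr2 sqr_ge0.
apply/rowP=> j; move: (h j (mem_index_enum _)) => /=.
by rewrite mxE mulf_eq0 orbb => /eqP.
Qed.

Lemma enorm_ge0 x : 0 <= enorm x.
Proof. exact: sqrtr_ge0. Qed.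

Lemma sqr_enorm x : enorm x ^+ 2 = dotv x x.
Proof. by rewrite sqr_sqrtr ?dotv_ge0. Qed.

Lemma enorm_eq0 x : (enorm x == 0) = (x == 0).
Proof. by rewrite -dotv_eq0 -sqr_enorm sqrf_eq0. Qed.

Lemma enorm0 : enorm (0 : 'rV[R]_n) = 0.
Proof. by apply/eqP; rewrite enorm_eq0. Qed.

Lemma enorm_gt0 x : (0 < enorm x) = (x != 0).
Proof. by rewrite lt_neqAle enorm_ge0 andbT eq_sym enorm_eq0. Qed.

Lemma enormZ a x : enorm (a *: x) = `|a| * enorm x.
Proof.
by rewrite /enorm dotvZl dotvZr mulrA -expr2 sqrtrM ?sqr_ge0// sqrtr_sqr.
Qed.

Lemma enormN x : enorm (- x) = enorm x.
Proof. by rewrite -scaleN1r enormZ normrN normr1 mul1r. Qed.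

Lemma enormC x y : enorm (x - y) = enorm (y - x).
Proof. by rewrite -enormN opprB. Qed.

Lemma dotv_le_enorm x y : dotv x y <= enorm x * enorm y.
Proof.
have [->|x0] := eqVneq x 0.
  by rewrite enorm0 mul0r /dotv big1// => i _; rewrite mxE mul0r.
have [->|y0] := eqVneq y 0.
  by rewrite enorm0 mulr0 /dotv big1// => i _; rewrite mxE mulr0.
have xy0 : 0 < enorm x * enorm y by rewrite mulr_gt0 ?enorm_gt0.
have := dotv_ge0 (enorm y *: x - enorm x *: y).
rewrite dotvBl !dotvBr !dotvZl !dotvZr -!sqr_enorm (dotvC y x) => h.
rewrite -(ler_pM2l xy0); nra.
Qed.

Lemma enormD x y : enorm (x + y) <= enorm x + enorm y.
Proof.
rewrite -(@ler_pXn2r _ 2) ?nnegrE ?addr_ge0 ?enorm_ge0//.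
rewrite sqr_enorm dotvDl !dotvDr (dotvC y x) -!sqr_enorm.
by have := dotv_le_enorm x y; nra.
Qed.

Lemma enormB x y : enorm (x - y) <= enorm x + enorm y.
Proof. by rewrite -(enormN y) enormD. Qed.

Lemma enorm_triangle y x z : enorm (x - z) <= enorm (x - y) + enorm (y - z).
Proof. by rewrite -[x - z](subrKA y) enormD. Qed.

Lemma coord_le_enorm x i : `|x 0 i| <= enorm x.
Proof.
rewrite -sqrtr_sqr /enorm ler_wsqrtr// /dotv (bigD1 i)//= -expr2 lerDl.
by apply: sumr_ge0 => j _; rewrite -expr2 sqr_ge0.
Qed.

Lemma enorm_le_coord x a : 0 <= a -> (forall i, `|x 0 i| <= a) ->
  enorm x <= n%:R * a.
Proof.
move=> a0 xa; rewrite -[leRHS]ger0_norm ?mulr_ge0// -sqrtr_sqr ler_wsqrtr//.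
apply: (@le_trans _ _ (\sum_(i < n) a ^+ 2)).
  apply: ler_sum => i _; rewrite -expr2 -real_normK ?num_real//.
  by rewrite ler_pXn2r ?nnegrE.
rewrite sumr_const card_ord -[_ *+ n]mulr_natl exprMn ler_wpM2r ?sqr_ge0//.
by rewrite -natrX ler_nat; case: (n) => // k; rewrite -{1}(expn1 k.+1) leq_pexp2l.
Qed.

Lemma mx_norm_le_enorm x : `|x| <= enorm x.
Proof.
rewrite [`|x|]mx_normrE; apply: bigmax_le => [|[i j] _]; first exact: enorm_ge0.
by rewrite ord1; exact: coord_le_enorm.
Qed.

Lemma coord_le_mx_norm x i : `|x 0 i| <= `|x|.
Proof.
by rewrite [leRHS]mx_normrE; exact: (le_bigmax _ (fun p => `|x p.1 p.2|) (0, i)).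
Qed.

Lemma enorm_le_mx_norm x : enorm x <= n%:R * `|x|.
Proof. by apply: enorm_le_coord => // i; exact: coord_le_mx_norm. Qed.

End EuclideanNorm.

Section OrthogonalProjection.
Context {R : realType} {n : nat}.
Implicit Types (V : {vspace 'rV[R]_n}) (x y z : 'rV[R]_n).

Lemma orthproj_in V x : orthproj V x \in V.
Proof. by case: (orthprojP V x). Qed.

Lemma orthproj_dot V x z : z \in V -> dotv (orthproj V x) z = dotv x z.
Proof.
move=> zV; case: (orthprojP V x) => _ /(_ z zV)/eqP.
by rewrite dotvBl subr_eq0 eq_sym => /eqP.
Qed.

Lemma orthproj_unique V x y :
  y \in V -> (forall z, z \in V -> dotv y z = dotv x z) -> orthproj V x = y.
Proof.
move=> yV h; apply/eqP; rewrite -subr_eq0 -dotv_eq0.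
have dV : orthproj V x - y \in V by rewrite rpredB// orthproj_in.
by rewrite dotvBl h// orthproj_dot// subrr.
Qed.

Lemma orthproj_is_linear V : linear (orthproj V).
Proof.
move=> a x y; apply: orthproj_unique.
  by rewrite rpredD// ?rpredZ// orthproj_in.
by move=> z zV; rewrite !dotvDl !dotvZl !orthproj_dot.
Qed.

HB.instance Definition _ V := GRing.isLinear.Build R 'rV[R]_n 'rV[R]_n _
  (orthproj V) (orthproj_is_linear V).

Lemma enorm_orthproj V x : enorm (orthproj V x) <= enorm x.
Proof.
have [->|p0] := eqVneq (orthproj V x) 0; first by rewrite enorm0 enorm_ge0.
rewrite -(@ler_pM2l _ (enorm (orthproj V x))) ?enorm_gt0// -expr2 sqr_enorm.
rewrite {2}[orthproj V x]lock dotvC -lock orthproj_dot ?orthproj_in// mulrC.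
exact: dotv_le_enorm.
Qed.

End OrthogonalProjection.

Section AdaptedBasis.
Context {R : realType} {n m : nat}.

(** Cramer's rule for the identity matrix with one column replaced: the cofactors
    along that column are those of the identity. *)
Lemma det_replace_col (F : fieldType) (M : 'M[F]_m) (i : 'I_m) :
  (forall k l, l != i -> M k l = (k == l)%:R) -> \det M = M i i.
Proof.
move=> hM; rewrite (expand_det_col _ i) (bigD1 i)//= big1 => [|k ki].
  have -> : cofactor M i i = cofactor (1%:M : 'M[F]_m) i i.
    congr (_ * \det _); apply/matrixP => a b; rewrite !mxE hM//.
    by rewrite eq_sym neq_lift.
  have := mul_mx_adj (1%:M : 'M[F]_m) => /matrixP/(_ i i).
  by rewrite mul1mx det1 !mxE eqxx => ->; rewrite addr0 mulr1.
have -> : cofactor M k i = cofactor (1%:M : 'M[F]_m) k i.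
  congr (_ * \det _); apply/matrixP => a b; rewrite !mxE hM//.
  by rewrite eq_sym neq_lift.
have := mul_mx_adj (1%:M : 'M[F]_m) => /matrixP/(_ i k).
by rewrite mul1mx det1 !mxE eq_sym (negPf ki) => ->; rewrite mulr0.
Qed.

(** A maximal minor of any basis of [V] is invertible, and dividing by it turns the
    chosen columns into the identity.  By Cramer's rule the other entries are
    quotients of minors by the maximal one, hence at most 1 in absolute value.  So
    [V] is a graph over [m] coordinates with slopes bounded independently of [V],
    which is what makes all constants below uniform in [V]. *)
Lemma adapted_basis (V : {vspace 'rV[R]_n}) : \dim V = m ->
  exists (A : 'M[R]_(m, n)) (f : 'I_m -> 'I_n),
  [/\ forall i, row i A \in V,
      forall i k, A i (f k) = (i == k)%:R,
      forall i j, `|A i j| <= 1 &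
      forall y, y \in V -> y = \sum_i y 0 (f i) *: row i A].
Proof.
move=> dV.
pose B : 'M[R]_(m, n) := \matrix_i (vbasis V)`_i.
have BV (u : 'rV[R]_m) : u *m B \in V.
  rewrite mulmx_sum_row; apply: rpred_sum => i _.
  by rewrite rowK rpredZ// vbasis_mem// mem_nth// size_tuple dV.
have VB z : z \in V -> exists u : 'rV[R]_m, z = u *m B.
  move=> zV; exists (\row_i coord (vbasis V) (cast_ord (esym dV) i) z).
  rewrite mulmx_sum_row [LHS](coord_vbasis zV) (reindex (cast_ord (esym dV)))/=.
    by apply: eq_bigr => i _; rewrite rowK mxE.
  by exists (cast_ord dV) => i _; rewrite ?cast_ordK ?cast_ordKV.
have rB : row_free B.
  rewrite -kermx_eq0; apply/eqP/row_matrixP => i; rewrite row0.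
  have : row i (kermx B) *m B = 0 by rewrite -row_mul mulmx_ker row0.
  move: (row i _) => u u0; have /freeP fr := basis_free (vbasisP V).
  apply/rowP=> j; rewrite [RHS]mxE.
  rewrite -[j](cast_ordKV dV).
  apply: (fr (fun j => u 0 (cast_ord dV j))); rewrite -[RHS]u0 mulmx_sum_row.
  rewrite [RHS](reindex (cast_ord dV))/=.
    by apply: eq_bigr=> k _; rewrite rowK.
  by exists (cast_ord (esym dV)) => k _; rewrite ?cast_ordK ?cast_ordKV.
pose g : {ffun 'I_m -> 'I_n} -> R := fun f => `|\det (colsub f B)|.
have [f0 f0P] : exists f0 : {ffun 'I_m -> 'I_n}, 0 < g f0.
  have fB : row_full B^T by rewrite /row_full mxrank_tr.
  exists [ffun i => fullrankfun fB i]; rewrite normr_gt0 -unitfE -unitmxE.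
  have -> : colsub [ffun i => fullrankfun fB i] B = (rowsub (fullrankfun fB) B^T)^T.
    by apply/matrixP => i j; rewrite !mxE ffunE.
  by rewrite unitmx_tr fullrowsub_unit.
have [f fmax] : exists f : {ffun 'I_m -> 'I_n}, forall h, g h <= g f.
  by exists [arg max_(h > f0) g h]%O => h; case: arg_maxP => // i _; apply.
have fpos : 0 < g f := lt_le_trans f0P (fmax f0).
have fu : colsub f B \in unitmx by rewrite unitmxE unitfE -normr_gt0.
pose A := invmx (colsub f B) *m B.
have csA (h : 'I_m -> 'I_n) : colsub h A = invmx (colsub f B) *m colsub h B.
  by apply/matrixP => i j; rewrite !mxE; apply: eq_bigr => k _; rewrite !mxE.
have Af i k : A i (f k) = (i == k)%:R.
  by have := csA f => /matrixP/(_ i k); rewrite mulVmx// !mxE.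
exists A, f; split=> //.
- by move=> i; rewrite /A row_mul.
- move=> i j.
  (* Replacing the column [f i] by [j] gives another minor of [B], whose quotient
     by the maximal one is [A i j]. *)
  pose h := [ffun k => if k == i then j else f k].
  have : \det (colsub h A) = A i j.
    rewrite (@det_replace_col _ _ i) => [|k l li]; first by rewrite mxE ffunE eqxx.
    by rewrite mxE ffunE (negPf li) Af.
  rewrite csA det_mulmx det_inv => <-.
  rewrite normrM normfV mulrC ler_pdivrMr// mul1r; exact: fmax.
- move=> y /VB[u ->].
  rewrite {1}(_ : u = u *m colsub f B *m invmx (colsub f B)); last first.
    by rewrite mulmxK.
  rewrite -mulmxA -/A mulmx_sum_row; apply: eq_bigr => i _; congr (_ *: _).
  by rewrite !mxE; apply: eq_bigr => k _; rewrite !mxE.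
Qed.

End AdaptedBasis.

(** * Borel functions and weighted sums of indicators *)

Section BorelMeasurability.
Context {R : realType} {T : ptopologicalType}.

Lemma borel_open (A : set T) : open A -> measurable (A : set (borelType T)).
Proof. exact: sub_sigma_algebra. Qed.

Lemma borel_closed (A : set T) : closed A -> measurable (A : set (borelType T)).
Proof.
move=> cA; rewrite -[A]setCK; apply: measurableC.
by apply: borel_open; exact: closed_openC.
Qed.

Lemma borel_continuous (f : T -> R) : continuous f ->
  measurable_fun setT (f : borelType T -> R).
Proof.
move=> /continuousP cf; apply: (measurability _ (RGenOInfty.measurableE R)).
move=> _ [_ [a ->] <-]; rewrite setTI; apply: borel_open.
exact/cf/interval_open.
Qed.

End BorelMeasurability.

Lemma continuous_sum (R : realType) (T : topologicalType) (I : Type)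
    (r : seq I) (P : pred I) (F : I -> T -> R) :
  (forall i, continuous (F i)) ->
  continuous (fun x => \sum_(i <- r | P i) F i x).
Proof.
move=> cF x; elim: r => [|i r ih].
  rewrite (_ : (fun _ => _) = cst 0); first exact: cvg_cst.
  by apply/funext => y; rewrite big_nil.
case Pi: (P i); last first.
  rewrite (_ : (fun _ => _) = (fun x => \sum_(i <- r | P i) F i x)); first exact: ih.
  by apply/funext => y; rewrite big_cons Pi.
rewrite (_ : (fun _ => _) = (fun x => F i x + \sum_(i <- r | P i) F i x)).
  by apply: cvgD; [exact: cF|exact: ih].
by apply/funext => y; rewrite big_cons Pi.
Qed.

Lemma enorm_continuous (R : realType) n : continuous (@enorm R n).
Proof.
move=> x; apply: (@continuous_comp _ _ _ (fun x => dotv x x) Num.sqrt).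
  apply: continuous_sum => i y.
  have c : continuous (fun z : 'rV[R]_n => z 0 i) by exact: coord_continuous.
  exact: (cvgM (c y) (c y)).
exact: sqrt_continuous.
Qed.

Lemma integral_sum_indic d (T : measurableType d) (R : realType)
    (P : probability T R) (I : finType) (w : I -> R) (S : I -> set T) :
  (forall i, 0 <= w i) -> (forall i, measurable (S i)) ->
  (\int[P]_x (\sum_i w i * \1_(S i) x)%:E = (\sum_i w i * fine (P (S i)))%:E)%E.
Proof.
move=> w0 mS; under eq_integral do rewrite -sumEFin.
rewrite ge0_integral_sum//; last 2 first.
- by move=> i; apply/measurable_EFinP; exact: measurable_funM.
- by move=> i x _; rewrite lee_fin mulr_ge0.
rewrite -sumEFin; apply: eq_bigr => i _.
under eq_integral do rewrite EFinM.
rewrite ge0_integralZl//.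
- by rewrite integral_indic// setIT EFinM fineK// fin_num_measure.
- by apply/measurable_EFinP; exact: measurable_indic.
- by rewrite lee_fin.
Qed.

Lemma measurable_sum_indic d (T : measurableType d) (R : realType)
    (I : finType) (w : I -> R) (S : I -> set T) :
  (forall i, measurable (S i)) ->
  measurable_fun setT (fun x => \sum_i w i * \1_(S i) x).
Proof.
move=> mS; apply: measurable_sum => i; apply: measurable_funM => //.
Qed.

(** Double counting: the weighted sum of the measures is the integral of a function
    bounded by [b]. *)
Lemma sum_measure_le d (T : measurableType d) (R : realType)
    (P : probability T R) (I : finType) (w : I -> R) (S : I -> set T) (b : R) :
  (forall i, 0 <= w i) -> (forall i, measurable (S i)) ->
  (forall x, \sum_i w i * \1_(S i) x <= b) ->
  \sum_i w i * fine (P (S i)) <= b.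
Proof.
move=> w0 mS hb; rewrite -lee_fin -integral_sum_indic//.
rewrite -[leRHS]mule1 -(@probability_setT _ _ _ P) -integral_cst//.
apply: ge0_le_integral => //.
- by move=> x _; rewrite lee_fin; apply: sumr_ge0 => i _; rewrite mulr_ge0.
- by apply/measurable_EFinP; exact: measurable_sum_indic.
- by move=> x _; rewrite lee_fin.
Qed.

Lemma sum_indic_markov d (T : measurableType d) (R : realType)
    (P : probability T R) (I : finType) (w : I -> R) (S : I -> set T) (b : R)
    (B := [set x | b < \sum_i w i * \1_(S i) x]) :
  0 <= b -> (forall i, 0 <= w i) -> (forall i, measurable (S i)) ->
  measurable B /\ b * fine (P B) <= \sum_i w i * fine (P (S i)).
Proof.
move=> b0 w0 mS.
have mB : measurable B.
  have := @measurable_sum_indic _ _ _ _ w S mS measurableT `]b, +oo[%classic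
    (measurable_itv _).
  rewrite setTI (_ : _ @^-1` _ = B)//.
  by apply/seteqP; split=> x /=; rewrite in_itv/= andbT.
split=> //; rewrite -lee_fin -integral_sum_indic// EFinM fineK ?fin_num_measure//.
rewrite -integral_cst// integral_mkcond.
apply: ge0_le_integral => //.
- by move=> x _; rewrite patchE; case: ifP.
- by apply/(measurable_restrictT _ _).1.
- by apply/measurable_EFinP; exact: measurable_sum_indic.
move=> x _; rewrite patchE; case: ifPn => [|_].
  by rewrite inE /B /= lee_fin => /ltW.
by rewrite lee_fin; apply: sumr_ge0 => i _; rewrite mulr_ge0.
Qed.

(** * The measure of a slab of subspaces *)

(** The reflection in the hyperplane orthogonal to [x - y] exchanges [x] and [y]. *)
Lemma orthogonal_transitive (R : realType) n (x y : 'rV[R]_n) :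
  enorm x = enorm y -> exists2 A : 'M[R]_n, A *m A^T = 1%:M & x *m A = y.
Proof.
move=> xy; have [<-|nxy] := eqVneq x y.
  by exists 1%:M; rewrite ?trmx1 mulmx1.
have [w [q [wE q0 xw wwT]]] : exists w q,
    [/\ w = x - y, q != 0, dotv x w *+ 2 = q & w *m w^T = q%:M].
  exists (x - y), (dotv (x - y) (x - y)); split=> //.
  - by rewrite dotv_eq0 subr_eq0.
  - by rewrite !dotvBl !dotvBr (dotvC y x) -!sqr_enorm xy; ring.
  - by apply/matrixP => i j; rewrite !ord1 -dotvE mxE eqxx.
pose H : 'M[R]_n := 1%:M - (2 / q) *: (w^T *m w).
exists H.
  have -> : H^T = H by rewrite /H linearB/= trmx1 linearZ/= trmx_mul trmxK.
  have ww : (w^T *m w) *m (w^T *m w) = q *: (w^T *m w).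
    by rewrite mulmxA -(mulmxA w^T) wwT mul_mx_scalar scalemxAl.
  rewrite {1}/H mulmxBl mul1mx /H mulmxBr mulmx1 -!scalemxAl -!scalemxAr ww.
  rewrite !scalerA -addrA -opprD -[RHS]subr0; congr (_ - _).
  rewrite -scalerBl -scalerDl (_ : _ + _ = 0) ?scale0r//.
  by field.
rewrite /H mulmxBr mulmx1 -scalemxAr mulmxA.
have -> : x *m w^T = (dotv x w)%:M.
  by apply/matrixP => i j; rewrite !ord1 -dotvE mxE eqxx.
rewrite mul_scalar_mx scalerA (_ : 2 / q * _ = 1); first by rewrite scale1r wE subKr.
rewrite -xw -mulr_natl; field.
by move: q0; rewrite -xw -mulr_natl mulf_eq0 negb_or => /andP[].
Qed.

Section SlabCount.
Context {R : realType} {n m : nat}.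
Variables (A : 'M[R]_(m, n)) (f : 'I_m -> 'I_n).
Hypothesis Af : forall i k, A i (f k) = (i == k)%:R.

Lemma adapted_inj : injective f.
Proof.
move=> i k fik; have := Af i k; rewrite -fik Af eqxx.
by case: eqVneq => // _ /eqP; rewrite oner_eq0.
Qed.

(** Translating [x] by [h k] along the coordinates [f] shifts the [i]-th linear form
    [\sum_j A i j * x j] by exactly [h k_i], and [h] exceeds the width of the slab.
    The [K ^ m] translates of the grid points of the slab are therefore pairwise
    distinct, and all of them lie in a grid of side [2 M.+1]. *)
Lemma slab_count (M K h : nat) (delta : R) :
  2 * delta < h%:R -> (h * K <= M.+1)%N ->
  (#|[set x : {ffun 'I_n -> 'I_M.+1} |
      [forall i, (`|\sum_j A i j * (x j)%:R| <= delta)%R]]%SET| * K ^ m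
    <= (2 * M.+1) ^ n)%N.
Proof.
move=> dh hKM.
set S := [set x | _]%SET.
pose s (k : {ffun 'I_m -> 'I_K}) (j : 'I_n) : nat := (\sum_(l | f l == j) k l)%N.
pose t (p : {ffun 'I_n -> 'I_M.+1} * {ffun 'I_m -> 'I_K}) :
    {ffun 'I_n -> 'I_(2 * M.+1).-1.+1} := [ffun j => inord (p.1 j + h * s p.2 j)].
have sf k i : s k (f i) = k i.
  by rewrite /s (big_pred1 i)// => l /=; rewrite (inj_eq adapted_inj).
have hs k j : (h * s k j <= M.+1)%N.
  case: (pickP (fun l => f l == j)) => [l /eqP <-|no].
    by rewrite sf (leq_trans _ hKM)// leq_mul2l ltnW ?orbT.
  by rewrite /s big_pred0// muln0.
have tE x k j : t (x, k) j = (x j + h * s k j)%N :> nat.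
  rewrite ffunE /= inordK//; have := ltn_ord (x j); have := hs k j; lia.
have tA x k i : \sum_j A i j * (t (x, k) j)%:R =
    \sum_j A i j * (x j)%:R + h%:R * (k i)%:R.
  under eq_bigr do rewrite tE natrD natrM mulrDr.
  rewrite big_split/=; congr (_ + _).
  have E j : A i j * (h%:R * (s k j)%:R) =
      h%:R * \sum_(l | f l == j) A i (f l) * (k l)%:R.
    rewrite /s natr_sum mulrCA; congr (_ * _); rewrite mulr_sumr.
    by apply: eq_bigr => l /eqP ->.
  under eq_bigr do rewrite E.
  rewrite -mulr_sumr; congr (_ * _).
  transitivity (\sum_l A i (f l) * (k l)%:R).
    by rewrite [RHS](partition_big f predT).
  rewrite (bigD1 i)//= Af eqxx mul1r big1 ?addr0// => l li.
  by rewrite Af eq_sym (negPf li) mul0r.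
have -> : (K ^ m = #|[set: {ffun 'I_m -> 'I_K}]%SET|)%N.
  by rewrite cardsT card_ffun !card_ord.
rewrite -cardsX.
have -> : ((2 * M.+1) ^ n = #|{ffun 'I_n -> 'I_(2 * M.+1).-1.+1}|)%N.
  by rewrite card_ffun !card_ord mulnS.
rewrite -(card_in_imset (f := t)); first exact: max_card.
move=> [x k] [x' k']; rewrite !inE !andbT /= => /forallP xS /forallP xS' tt.
have kk : k = k'.
  apply/ffunP => i; apply/val_inj => /=.
  have := tA x k i; rewrite tt tA => e.
  have := xS i; have := xS' i; rewrite !ler_norml => /andP[a1 a2] /andP[b1 b2].
  have lt1 : h%:R * (k i)%:R - h%:R * (k' i)%:R < h%:R :> R by lra.
  have lt2 : h%:R * (k' i)%:R - h%:R * (k i)%:R < h%:R :> R by lra.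
  move: lt1 lt2; rewrite !ltrBlDr -!natrM -!natrD !ltr_nat.
  rewrite -!mulnS !ltn_mul2l !ltnS => /andP[_ h1] /andP[_ h2].
  by apply/eqP; rewrite eqn_leq h1 h2.
congr (_, _) => //; apply/ffunP => j; apply/val_inj => /=.
have := congr1 (fun g : {ffun 'I_n -> 'I_(2 * M.+1).-1.+1} => nat_of_ord (g j)) tt.
by rewrite /= !tE kk => /eqP; rewrite eqn_add2r => /eqP.
Qed.

End SlabCount.

(** This form of the kernel has no case distinction at the origin and shows that it
    is continuous and decreasing in the distance. *)
Lemma phiE (R : realType) n (m : nat) (r : R) (x : 'rV[R]_n) : 0 < r ->
  phi m%:R r x = (r / Num.max r (enorm x)) ^+ m.
Proof.
move=> r0; rewrite /phi; case: eqVneq => [->|x0].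
  by rewrite enorm0 (max_l (ltW r0)) divff ?gt_eqF// expr1n.
have e0 : 0 < enorm x by rewrite enorm_gt0.
rewrite powR_mulrn ?divr_ge0 ?ltW//.
have [rx|xr] := leP (enorm x) r.
  rewrite divff ?gt_eqF// expr1n min_l// exprn_ege1//.
  by rewrite ler_pdivlMr// mul1r.
rewrite min_r// exprn_ile1 ?divr_ge0 ?ltW//.
by rewrite ltr_pdivrMr// mul1r.
Qed.

Section Slabs.
Context {R : realType} {n m : nat} {le_mn : (m <= n)%N}.
Local Notation G := (Grassmannian R le_mn).

Definition slab (x : 'rV[R]_n) (delta : R) : set G :=
  [set V | enorm (orthproj V x) <= delta].

Lemma orthproj_mulmx (V : G) x : orthproj V x = x *m projmx V.
Proof. by rewrite mul_rV_lin1. Qed.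

(** The topology is pulled back from the projection matrices, and [orthproj V x]
    depends continuously on the projection matrix of [V]. *)
Lemma slab_measurable x delta : measurable (slab x delta : set (borelType G)).
Proof.
apply: borel_closed.
pose g (P : 'M[R]_n) :=
  \sum_j (\sum_i x 0 i * P i j) * (\sum_i x 0 i * P i j).
pose f P := Num.sqrt (g P).
have cf : continuous f.
  move=> P; apply: (@continuous_comp _ _ _ g Num.sqrt).
    apply: continuous_sum => j Q.
    have c : continuous (fun P : 'M[R]_n => \sum_i x 0 i * P i j).
      apply: continuous_sum => i S.
      have e : continuous (fun P : 'M[R]_n => P i j) by exact: coord_continuous.
      exact: (cvgM (cvg_cst (x 0 i)) (e S)).
    exact: (cvgM (c Q) (c Q)).
  exact: sqrt_continuous.
have -> : slab x delta = (f \o projmx) @^-1` [set y | y <= delta].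
  have E P : f P = enorm (x *m P).
    rewrite /f /g /enorm /dotv; congr Num.sqrt.
    by apply: eq_bigr => j _; rewrite !mxE.
  by apply/seteqP; split=> V; rewrite /slab /= orthproj_mulmx E.
apply: closed_comp; last exact: closed_le.
move=> V _; apply: continuous_comp; last exact: cf.
exact: initial_continuous.
Qed.

Lemma orthproj_image (A : 'M[R]_n) (V W : G) x : A *m A^T = 1%:M ->
  (W = (linfun (mulmxr A) @: V)%VS :> {vspace 'rV[R]_n}) ->
  orthproj W (x *m A) = orthproj V x *m A.
Proof.
move=> AA WV.
have dA u v : dotv (u *m A) (v *m A) = dotv u v.
  by rewrite !dotvE trmx_mul mulmxA -(mulmxA u) AA mulmx1.
apply: orthproj_unique; rewrite WV.
  have -> : orthproj V x *m A = linfun (mulmxr A) (orthproj V x) by rewrite lfunE.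
  by rewrite memv_img// orthproj_in.
move=> z /memv_imgP[v vV ->]; rewrite lfunE /= !dA.
exact: orthproj_dot.
Qed.

Lemma enorm_orthogonal (A : 'M[R]_n) (x : 'rV[R]_n) : A *m A^T = 1%:M ->
  enorm (x *m A) = enorm x.
Proof.
by move=> AA; rewrite /enorm !dotvE trmx_mul mulmxA -(mulmxA x) AA mulmx1.
Qed.

Lemma orthogonal_image_slab (A : 'M[R]_n) x delta : A *m A^T = 1%:M ->
  orthogonal_image A (slab x delta) = slab (x *m A) delta.
Proof.
move=> AA; apply/seteqP; split=> [W [V Vx WV]|W Wx].
  by rewrite /slab /= (orthproj_image x AA WV) enorm_orthogonal.
have AtA := mulmx1C AA.
pose f := linfun (mulmxr A^T) : 'End('rV[R]_n).
have fW : \dim (f @: W)%VS == m.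
  rewrite limg_dim_eq ?dim_subspace//; apply/eqP; rewrite -subv0.
  apply/subvP => v; rewrite memv_cap memv_ker lfunE /= => /andP[_ /eqP v0].
  by rewrite memv0 -[v]mulmx1 -AtA mulmxA v0 mul0mx.
pose V : G := Subspace le_mn _ fW.
have WV : W = (linfun (mulmxr A) @: V)%VS :> {vspace 'rV[R]_n}.
  rewrite /= -limg_comp; apply/vspaceP => w; apply/idP/memv_imgP => [wW|[u uW ->]].
    by exists w => //; rewrite comp_lfunE !lfunE /= -mulmxA AtA mulmx1.
  by rewrite comp_lfunE !lfunE /= -mulmxA AtA mulmx1.
by exists V => //; rewrite /slab /= -(enorm_orthogonal _ AA) -(orthproj_image x AA WV).
Qed.

Section InvariantMeasure.
Variable gamma : probability (borelType G) R.
Hypothesis gammaP : orthogonally_invariant gamma.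

Lemma slab_measure_rot x y delta : enorm x = enorm y ->
  gamma (slab x delta) = gamma (slab y delta).
Proof.
move=> /orthogonal_transitive[A AA <-].
by rewrite -orthogonal_image_slab// gammaP//; exact: slab_measurable.
Qed.

Lemma slab_scale a x delta : 0 < a -> slab (a *: x) (a * delta) = slab x delta.
Proof.
move=> a0; apply/seteqP; split=> V; rewrite /slab /= linearZ enormZ gtr0_norm//;
  by rewrite ler_pM2l.
Qed.

(** Invariance makes the measure depend only on the norm of the vector, and slabs are
    homogeneous; so the measure is a function of the ratio of width to norm. *)
Lemma slab_measure_homogeneous x y rho : x != 0 -> y != 0 ->
  gamma (slab x (rho * enorm x)) = gamma (slab y (rho * enorm y)).
Proof.
move=> x0 y0; have ex : 0 < enorm x by rewrite enorm_gt0.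
have ey : 0 < enorm y by rewrite enorm_gt0.
rewrite -(slab_scale x (rho * enorm x) (divr_gt0 ey ex)).
rewrite (_ : enorm y / enorm x * (rho * enorm x) = rho * enorm y); last by field; lra.
apply: slab_measure_rot; rewrite enormZ gtr0_norm ?divr_gt0//.
by field; lra.
Qed.

(** If [orthproj V x] is short then so are its scalar products with the vectors of
    the adapted basis of [V], which puts [x] in the slab counted by [slab_count]. *)
Lemma slab_count_grassmannian (V : G) (rho : R) K : (0 < K)%N -> 0 <= rho ->
  4 * n%:R ^+ 2 * rho * K%:R <= 1 ->
  (#|[set x : {ffun 'I_n -> 'I_(2 * K).-1.+1} |
     `[< slab (\row_j (x j)%:R) (rho * enorm (\row_j (x j)%:R : 'rV[R]_n)) V >]]%SET|
     * K ^ m <= (2 * (2 * K).-1.+1) ^ n)%N.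
Proof.
move=> K0 rho0 hK.
have [A [f [AV Af A1 _]]] := adapted_basis (eqP (dim_subspace V)).
set M := (2 * K).-1; have ME : (M.+1 = 2 * K)%N by rewrite /M; lia.
pose delta : R := n%:R * (rho * (n%:R * M.+1%:R)).
have hd : 2 * delta < 2%:R.
  have -> : 2 * delta = 4 * n%:R ^+ 2 * rho * K%:R by rewrite /delta ME natrM; ring.
  by rewrite (le_lt_trans hK)// ltr1n.
have hM : (2 * K <= M.+1)%N by rewrite ME.
apply: leq_trans (slab_count Af hd hM); rewrite leq_mul2r; apply/orP; right.
apply/subset_leq_card/fintype.subsetP => x; rewrite !inE => /asboolP; rewrite /slab /=.
set v := \row_j _ => vV; apply/forallP => i.
have vn : enorm v <= n%:R * M.+1%:R.
  apply: enorm_le_coord => // j; rewrite mxE ger0_norm// ler_nat.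
  exact: ltnW.
have -> : \sum_j A i j * (x j)%:R = dotv (orthproj V v) (row i A).
  rewrite orthproj_dot//; apply: eq_bigr => j _; rewrite !mxE mulrC//.
rewrite (le_trans (ler_norm_sum _ _ _))// /delta mulr_natl.
rewrite -[X in _ *+ X]card_ord -sumr_const; apply: ler_sum => j _.
rewrite normrM -[leRHS]mulr1 ler_pM// ?mxE//.
apply: le_trans (coord_le_enorm _ _) _.
move/asboolP: vV => vV; apply: le_trans vV _.
by rewrite ler_wpM2l.
Qed.

Definition slab_const : R := 2 ^+ n.+1 * (8 * n%:R ^+ 2) ^+ m.

Hypothesis n0 : (0 < n)%N.

Lemma slab_const_ge1 : 1 <= slab_const.
Proof.
have h : 1 <= n%:R ^+ 2 :> R by rewrite exprn_ege1// ler1n.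
by rewrite /slab_const mulr_ege1// exprn_ege1//; lra.
Qed.

(** All nonzero points of a grid have the same probability of being almost orthogonal
    to [V].  Summing these probabilities over the grid and exchanging the sum with the
    integral reduces the estimate to counting grid points for one fixed [V]. *)
Lemma slab_measure_homogeneous_le x rho : x != 0 -> 0 < rho ->
  fine (gamma (slab x (rho * enorm x))) <= slab_const * rho ^+ m.
Proof.
move=> x0 rho0.
have n1 : 1 <= n%:R ^+ 2 :> R by rewrite exprn_ege1// ler1n.
set a : R := 4 * n%:R ^+ 2 * rho.
have a0 : 0 < a by rewrite /a; nra.
have cE : slab_const * rho ^+ m = 2 ^+ n.+1 * (2 * a) ^+ m.
  by rewrite /slab_const /a -mulrA -exprMn; congr (_ * _ ^+ _); ring.
rewrite cE.
have p1 : fine (gamma (slab x (rho * enorm x))) <= 1.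
  rewrite -lee_fin fineK ?fin_num_measure ?probability_le1//; exact: slab_measurable.
have [a1|a1] := leP 1 a.
  apply: le_trans p1 _; rewrite -[leLHS]mulr1 ler_pM// ?exprn_ege1//; lra.
(* With the grid of side [2 K] and translation step 2, the slab has width
   at most [K * a <= 1], which is less than the step. *)
pose K := Num.truncn a^-1.
have ai : 1 < a^-1 by rewrite invf_gt1.
have /andP[Ka aK] : K%:R <= a^-1 < K.+1%:R by apply: truncn_itv; rewrite ltW// invr_gt0.
have K0 : (0 < K)%N by move: (lt_trans ai aK); rewrite ltr1n ltnS.
have K1 : 1 <= K%:R :> R by rewrite ler1n.
have hK : a * K%:R <= 1 by rewrite mulrC -ler_pdivlMr// mul1r.
set M := (2 * K).-1; have ME : (M.+1 = 2 * K)%N by rewrite /M; lia.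
pose v (y : {ffun 'I_n -> 'I_M.+1}) : 'rV[R]_n := \row_j (y j)%:R.
pose w (y : {ffun 'I_n -> 'I_M.+1}) : R := (v y != 0)%:R.
pose S y : set G := slab (v y) (rho * enorm (v y)).
have w0 y : 0 <= w y by [].
have mS y : measurable (S y : set (borelType G)) by exact: slab_measurable.
have bound V : \sum_y w y * \1_(S y) V <= (4 * K%:R) ^+ n / K%:R ^+ m.
  rewrite ler_pdivlMr ?exprn_gt0 ?(lt_le_trans _ K1)//.
  have := slab_count_grassmannian V K0 (ltW rho0) hK.
  rewrite -/M (_ : (2 * M.+1)%N = (4 * K)%N); last by rewrite ME mulnA.
  rewrite -(ler_nat R) natrM !natrX natrM; apply: le_trans.
  rewrite ler_wpM2r ?exprn_ge0// -sum1_card natr_sum [leRHS]big_mkcond/=.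
  apply: ler_sum => y _; rewrite !inE indicE.
  rewrite (_ : (V \in S y) = `[< S y V >]); last first.
    by apply/idP/asboolP => [/set_mem|/mem_set].
  rewrite -/(v y) -/(S y); case: ifP => _; last by rewrite mulr0.
  by rewrite mulr1 /w; case: (v y != 0).
have := sum_measure_le gamma w0 mS bound.
have -> : \sum_y w y * fine (gamma (S y)) =
    (\sum_y w y) * fine (gamma (slab x (rho * enorm x))).
  rewrite mulr_suml; apply: eq_bigr => y _; rewrite /w.
  by case: eqVneq => [|vy]; rewrite ?mul0r// /S (slab_measure_homogeneous rho vy x0).
have wE : (2 * K%:R) ^+ n / 2 <= \sum_y w y.
  have -> : \sum_y w y = (2 * K%:R) ^+ n - 1.
    have -> : (2 * K%:R) ^+ n = \sum_(y : {ffun 'I_n -> 'I_M.+1}) 1 :> R.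
      by rewrite sumr_const card_ffun !card_ord ME natrX natrM.
    rewrite (bigD1 [ffun => ord0])//= [in RHS](bigD1 [ffun => ord0])//=.
    rewrite {1}/w (_ : v _ = 0) ?eqxx ?add0r; last first.
      by apply/rowP => j; rewrite !mxE ffunE.
    rewrite addrC addrK; apply: eq_bigr => y y0; rewrite /w.
    case: eqVneq => // vy; case/eqP: y0; apply/ffunP => j; apply/val_inj.
    have /rowP/(_ j) := vy; rewrite !mxE ffunE => /eqP.
    by rewrite pnatr_eq0 => /eqP.
  have : 2 <= (2 * K%:R) ^+ n :> R.
    rewrite -(prednK n0) exprS; apply: le_trans (_ : 2 * 1 <= _); first lra.
    by rewrite ler_pM// ?exprn_ege1//; lra.
  lra.
move: (fine _) p1 => p p1 hp.
have [p0|p0] := leP p 0.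
  by apply: le_trans p0 _; rewrite mulr_ge0 ?exprn_ge0//; lra.
have hp2 : (2 * K%:R) ^+ n / 2 * p <= (4 * K%:R) ^+ n / K%:R ^+ m.
  by apply: le_trans hp; rewrite ler_wpM2r// ltW.
have e4 : (4 * K%:R) ^+ n = 2 ^+ n * (2 * K%:R) ^+ n :> R.
  by rewrite -exprMn mulrA; congr ((_ * _) ^+ _); lra.
have P0 : 0 < (2 * K%:R) ^+ n :> R by rewrite exprn_gt0//; lra.
have {hp2} : p <= 2 ^+ n.+1 * (K%:R ^+ m)^-1.
  rewrite -(ler_pM2l P0) exprS; move: hp2; rewrite e4 => h; lra.
move=> /le_trans -> //; rewrite ler_pM2l ?exprn_gt0// -exprVn lerXn2r//.
- by rewrite nnegrE invr_ge0; lra.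
- by rewrite nnegrE; lra.
have aKK : 1 <= a * K.+1%:R by rewrite mulrC -ler_pdivrMr// mul1r ltW.
rewrite -div1r ler_pdivrMr; last lra.
by apply: le_trans aKK _; rewrite -natr1; nra.
Qed.

(** For vectors of norm at most [r] the kernel is 1; for the others this is the
    homogeneous estimate for the ratio [r / enorm x], whose [m]-th power is the
    kernel. *)
Lemma slab_measure_le (x : 'rV[R]_n) r : 0 < r ->
  fine (gamma (slab x r)) <= slab_const * phi m%:R r x.
Proof.
move=> r0; rewrite phiE//.
have [xr|rx] := leP (enorm x) r.
  rewrite divff ?gt_eqF// expr1n mulr1.
  apply: le_trans slab_const_ge1.
  rewrite -lee_fin fineK ?fin_num_measure ?probability_le1//; exact: slab_measurable.
have ex : 0 < enorm x := lt_trans r0 rx.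
have x0 : x != 0 by rewrite -enorm_gt0.
rewrite -{1}(@divfK _ (enorm x) _ r) ?gt_eqF//.
by apply: slab_measure_homogeneous_le => //; rewrite divr_gt0.
Qed.

End InvariantMeasure.
End Slabs.

(** * Energies and finitely supported measures *)

(** The integral of a nonnegative function is a supremum over the simple functions
    below it, hence monotone in an arbitrary nonnegative function.  Partial integrals
    can thus be compared directly with step functions. *)
Lemma ge0_le_integralT d (T : measurableType d) (R : realType)
    (mu : {measure set T -> \bar R}) (f g : T -> \bar R) :
  (forall x, 0 <= f x)%E -> (forall x, f x <= g x)%E ->
  (\int[mu]_x f x <= \int[mu]_x g x)%E.
Proof.
move=> f0 fg; have g0 x : (0 <= g x)%E := le_trans (f0 x) (fg x).
rewrite !ge0_integralTE//; apply: ereal_sup_le => _ [h /= hf <-].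
by exists h => // x; exact: le_trans (hf x) (fg x).
Qed.

Section EuclideanTopology.
Context {R : realType} {n : nat}.
Implicit Types (F : set 'rV[R]_n) (x y : 'rV[R]_n).

Lemma dist_continuous x : continuous (fun y => enorm (y - x)).
Proof.
move=> y; apply: (@continuous_comp _ _ _ (fun y => y - x) (@enorm R n)).
  apply: (@cvgB R 'rV[R]_n _ (nbhs y) _ id (cst x) y x); [exact: cvg_id|exact: cvg_cst].
exact: enorm_continuous.
Qed.

Lemma open_eball x (eta : R) : open [set y | enorm (y - x) < eta].
Proof.
have := @open_lt R eta; apply: open_comp => y _; exact: dist_continuous.
Qed.

Lemma compact_enorm_bounded F : compact F ->
  exists2 D : R, 0 < D & forall x, F x -> enorm x <= D.
Proof.
move=> /compact_bounded[M [_ hM]].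
pose D := n%:R * (`|M| + 1) + 1.
have M0 : 0 <= `|M| by [].
exists D; first by rewrite ltr_wpDl// mulr_ge0// addr_ge0.
move=> x Fx; apply: le_trans (enorm_le_mx_norm x) _.
apply: (@le_trans _ _ (n%:R * (`|M| + 1))); last by rewrite lerDl.
rewrite ler_wpM2l//; apply: hM => //.
by rewrite ltr_pwDr// ler_norm.
Qed.

Lemma compact_rV_closed F : compact F -> closed F.
Proof. by apply: compact_closed; exact: norm_hausdorff. Qed.

Lemma compact_net F (eta : R) : compact F -> 0 < eta ->
  exists N (x : 'I_N -> 'rV[R]_n),
    (forall i, F (x i)) /\ forall y, F y -> exists i, enorm (y - x i) < eta.
Proof.
rewrite compact_cover => cF eta0.
have [||D DF cD] := cF _ F (fun x => [set y | enorm (y - x) < eta]).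
- by move=> x _; exact: open_eball.
- by move=> y Fy; exists y => //=; rewrite subrr enorm0.
pose s : seq 'rV[R]_n := finmap.enum_fset D.
exists (size s), (fun i => tnth (in_tuple s) i); split=> [i|y Fy].
  by apply/set_mem/DF; exact: mem_tnth.
have [x xD /= yx] := cD y Fy.
have xs : x \in s by [].
have is_ : (index x s < size s)%N by rewrite index_mem.
by exists (Ordinal is_); rewrite (tnth_nth 0) /= nth_index.
Qed.

End EuclideanTopology.

Section Kernel.
Context {R : realType} {n m : nat}.
Implicit Types (x y : 'rV[R]_n) (r : R).

Lemma phi_ge0 r x : 0 < r -> 0 <= phi m%:R r x.
Proof.
move=> r0; rewrite phiE// exprn_ge0// divr_ge0 ?ltW//.
by rewrite lt_max r0.
Qed.

Lemma phi_le1 r x : 0 < r -> phi m%:R r x <= 1.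
Proof.
move=> r0; rewrite phiE// exprn_ile1//; last first.
  by rewrite ler_pdivrMr ?mul1r ?lt_max ?r0// le_max lexx.
by rewrite divr_ge0 ?ltW// lt_max r0.
Qed.

Lemma phi_le_phi (a r : R) x y : 0 < r -> 0 <= a ->
  Num.max r (enorm y) <= a * Num.max r (enorm x) ->
  phi m%:R r x <= a ^+ m * phi m%:R r y.
Proof.
move=> r0 a0 h; rewrite !phiE// -exprMn lerXn2r ?nnegrE//.
- by rewrite divr_ge0 ?ltW// lt_max r0.
- by rewrite mulr_ge0// divr_ge0 ?ltW// lt_max r0.
have X0 : 0 < Num.max r (enorm x) by rewrite lt_max r0.
have Y0 : 0 < Num.max r (enorm y) by rewrite lt_max r0.
rewrite ler_pdivrMr//.
rewrite (_ : _ * _ * _ =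
  r * (a * Num.max r (enorm x)) / Num.max r (enorm y)); last by ring.
by rewrite ler_pdivlMr// ler_pM2l.
Qed.

Lemma phi_shift_continuous r y : 0 < r ->
  continuous (fun x => phi m%:R r (x - y)).
Proof.
move=> r0; rewrite (_ : (fun _ => _) =
  fun x => (r / Num.max r (enorm (x - y))) ^+ m).
  move=> x; apply: (@continuous_comp _ _ _
    (fun x => r / Num.max r (enorm (x - y))) (fun t => t ^+ m)).
    have X0 : 0 < Num.max r (enorm (x - y)) by rewrite lt_max r0.
    have cm : {for x, continuous (cst r \max (fun x => enorm (x - y)))}.
      apply: continuous_max; first exact: (@cst_continuous _ R r x).
      exact: (@dist_continuous R n y x).
    have cV := cvgV (lt0r_neq0 X0) cm.
    exact: (@cvgM R _ (nbhs x) _ (cst r) _ r _ (cvg_cst r) (cV (nbhs_filter x))).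
  exact: exprn_continuous.
by apply/funext => x; rewrite phiE.
Qed.

End Kernel.

Section Capacity.
Context {R : realType} {n m : nat}.
Implicit Types (F : set 'rV[R]_n) (r : R).
Local Notation X := (borelType 'rV[R]_n).

Lemma phi_shift_measurable r (y : 'rV[R]_n) : 0 < r ->
  measurable_fun setT (fun x : X => (phi m%:R r ((x : 'rV[R]_n) - y))%:E).
Proof.
move=> r0; apply/measurable_EFinP.
exact: (@borel_continuous R 'rV[R]_n (fun x => phi m%:R r (x - y))
  (@phi_shift_continuous R n m r y r0)).
Qed.

(** Below the scale [r] the kernel is flat, and distances above it change at most by
    the factor 3. *)
Lemma phi_le_of_near r (x y x' y' : 'rV[R]_n) : 0 < r ->
  enorm (x - x') < r -> enorm (y - y') < r ->
  phi m%:R r (x' - y') <= 3 ^+ m * phi m%:R r (x - y).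
Proof.
move=> r0 xx yy; apply: phi_le_phi => //.
have : enorm (x - y) <= enorm (x - x') + enorm (x' - y') + enorm (y - y').
  rewrite (enormC y) -addrA; apply: le_trans (enorm_triangle x' _ _) _.
  by rewrite lerD2l enorm_triangle.
rewrite ge_max.
have : r <= Num.max r (enorm (x' - y')) by rewrite le_max lexx.
have : enorm (x' - y') <= Num.max r (enorm (x' - y')) by rewrite le_max lexx orbT.
move: (Num.max _ _) => M h1 h2 h3; apply/andP; split; lra.
Qed.

(** Cutting [F] into finitely many Borel pieces within [r] of points of a net, and
    moving the mass of each piece to its point, costs a constant factor in the energy.
    Working with finitely many atoms turns all later integrals over [F] into sums. *)
Lemma energy_discretization F (mu : probability X R) r :
  compact F -> mu (~` F) = 0%E -> 0 < r ->
  exists N (x : 'I_N -> 'rV[R]_n) (w : 'I_N -> R),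
    [/\ forall i, F (x i), forall i, 0 <= w i, \sum_i w i = 1 &
      ((\sum_i \sum_j w i * w j * phi m%:R r (x i - x j))%:E
        <= (3 ^+ m)%:E * energy m%:R r mu)%E].
Proof.
move=> cF muF r0.
have [N [x [Fx netx]]] := compact_net cF r0.
pose B i : set X := [set y | enorm (y - x i) < r].
have mB i : measurable (B i) by apply: borel_open; exact: open_eball.
have mF : measurable (F : set X) by apply: borel_closed; exact: compact_rV_closed.
(* Disjoint pieces: each point goes to the first ball that contains it. *)
pose C i : set X := (F : set X) `&` (B i `\` \big[setU/set0]_(j < N | (j < i)%N) B j).
have mC i : measurable (C i).
  by apply: measurableI => //; apply: measurableD => //; exact: bigsetU_measurable.
have CU y i j : C i y -> C j y -> i = j.
  wlog ij : i j / (i <= j)%N => [wl|].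
    by case: (leqP i j) => [/wl//|/ltnW/wl h a b]; rewrite h.
  move=> [_ [Bi _]] [_ [_ nBj]]; apply/val_inj/eqP; rewrite eqn_leq ij leqNgt.
  apply/negP => lij; apply: nBj; rewrite -bigcup_seq_cond/=.
  by exists i; rewrite //= mem_index_enum.
have CE y : F y -> exists i, C i y.
  move=> /[dup] Fy /netx[i0 yi0].
  have [i yi imin] := @arg_minnP _ i0 (fun i => `[< B i y >]) val (asboolT yi0).
  exists i; split=> //; split; first exact/asboolP.
  rewrite -bigcup_seq_cond/= => -[j /= /andP[_ ji] Bj].
  by have := imin j (asboolT Bj); rewrite leqNgt ji.
have sumC (a : 'I_N -> R) y i : C i y -> \sum_j a j * \1_(C j) y = a i.
  move=> Ci; rewrite (bigD1 i)//= big1 => [|j ji].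
    by rewrite addr0 indicE mem_set// mulr1.
  rewrite indicE memNset ?mulr0// => Cj.
  by move: ji; rewrite (CU _ _ _ Ci Cj) eqxx.
pose w i := fine (mu (C i)).
have w1 : \sum_i w i = 1.
  have := @integral_sum_indic _ _ _ mu _ (fun=> 1) C (fun=> ler01) mC.
  rewrite (_ : (fun _ => _) = (fun y => (\1_(F : set X) y)%:E)).
    rewrite integral_indic// setIT.
    have muF1 : mu (F : set X) = 1%E.
      have fF := fin_num_measure mu _ mF.
      have := probability_setC mu mF; rewrite muF -(fineK fF) -EFinB => /eqP.
      by rewrite eqe eq_sym subr_eq0 => /eqP <-.
    by move=> /(etrans (esym muF1)) [->]; apply: eq_bigr => i _; rewrite mul1r.
  apply/funext => y; congr EFin.
  have [Fy|nFy] := pselect (F y).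
    by have [i Ci] := CE y Fy; rewrite (sumC _ _ i)// indicE mem_set.
  rewrite [RHS]indicE memNset// big1// => i _.
  by rewrite indicE memNset ?mulr0// => -[].
exists N, x, w; split=> //; first by move=> i; exact: fine_ge0.
rewrite -lee_pdivrMl ?exprn_gt0// -EFinM.
have t0 : 0 <= (3 ^+ m)^-1 :> R by rewrite invr_ge0 exprn_ge0.
pose p i j : R := (3 ^+ m)^-1 * phi m%:R r (x i - x j).
have p0 i j : 0 <= p i j by rewrite mulr_ge0// phi_ge0.
pose q j : R := \sum_i p i j * w i.
have q0 j : 0 <= q j by apply: sumr_ge0 => i _; rewrite mulr_ge0// fine_ge0.
(* The kernel dominates a step function that is constant on products of pieces. *)
have inner y : ((\sum_j q j * \1_(C j) y)%:E <=
    \int[mu]_z (phi m%:R r ((z : 'rV[R]_n) - y))%:E)%E.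
  have [[j Cj]|nC] := pselect (exists j, C j y); last first.
    rewrite big1 => [|j _].
      by apply: integral_ge0 => z _; rewrite lee_fin phi_ge0.
    by rewrite indicE memNset ?mulr0// => Cj; apply: nC; exists j.
  rewrite (sumC _ _ j)// -(@integral_sum_indic _ _ _ mu _ (p ^~ j) C)//.
  apply: ge0_le_integralT => z; rewrite lee_fin.
    by apply: sumr_ge0 => i _; rewrite mulr_ge0.
  have [[i Ci]|nCz] := pselect (exists i, C i z); last first.
    rewrite big1 ?phi_ge0// => i _.
    by rewrite indicE memNset ?mulr0// => Ci; apply: nCz; exists i.
  rewrite (sumC _ _ i)// /p ler_pdivrMl ?exprn_gt0//.
  by apply: phi_le_of_near => //; [case: Ci => _ []|case: Cj => _ []].
apply: le_trans (_ : _ <= \int[mu]_y (\sum_j q j * \1_(C j) y)%:E)%E _; last first.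
  apply: ge0_le_integralT => y; last exact: inner.
  by rewrite lee_fin; apply: sumr_ge0 => i _; rewrite mulr_ge0.
rewrite integral_sum_indic// lee_fin exchange_big/= mulr_sumr; apply: ler_sum => j _.
rewrite /q mulr_suml mulr_sumr; apply: ler_sum => i _.
rewrite /p -/(w j); lra.
Qed.

End Capacity.
Arguments energy_discretization {R n} m {F mu r}.

Section UniformMeasure.
Context d (T : measurableType d) (R : realType) (N : nat) (x : nat -> T).

Let weight : {nonneg R} := (N.+1%:R^-1)%:nng.

Definition uniform_measure : set T -> \bar R :=
  mscale weight (msum (fun i => \d_(x i)) N.+1).

HB.instance Definition _ := Measure.on uniform_measure.

Lemma uniform_measure_setT : uniform_measure setT = 1%E.
Proof.
rewrite /uniform_measure /mscale/= /msum.
under eq_bigr do rewrite /= diracT.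
rewrite sumEFin -EFinM sumr_const card_ord mulVf// pnatr_eq0//.
Qed.

HB.instance Definition _ :=
  Measure_isProbability.Build d T R uniform_measure uniform_measure_setT.

Lemma uniform_measure_setC (F : set T) :
  (forall i, F (x i)) -> uniform_measure (~` F) = 0%E.
Proof.
move=> Fx; rewrite /uniform_measure /mscale/= /msum big1 ?mule0// => i _.
by rewrite /= diracE memNset//; apply; exact: Fx.
Qed.

Lemma uniform_measure_integral (f : T -> R) :
  (forall y, 0 <= f y) -> measurable_fun setT f ->
  (\int[uniform_measure]_y (f y)%:E = (N.+1%:R^-1 * \sum_(i < N.+1) f (x i))%:E)%E.
Proof.
move=> f0 mf; have mf' : measurable_fun setT (EFin \o f) by exact/measurable_EFinP.
rewrite ge0_integral_mscale//; last by move=> y _; rewrite lee_fin.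
rewrite ge0_integral_measure_sum//; last by move=> y _; rewrite lee_fin.
under eq_bigr do rewrite integral_dirac// diracT mul1e.
by rewrite sumEFin.
Qed.

End UniformMeasure.

Section Capacity.
Context {R : realType} {n m : nat}.
Implicit Types (F : set 'rV[R]_n) (r : R).
Local Notation X := (borelType 'rV[R]_n).

Lemma phiN r (x : 'rV[R]_n) : 0 < r -> phi m%:R r (- x) = phi m%:R r x.
Proof. by move=> r0; rewrite !phiE// enormN. Qed.

Lemma uniform_energy N (x : nat -> 'rV[R]_n) r : 0 < r ->
  (energy m%:R r (@uniform_measure _ X R N x) =
  (N.+1%:R^-1 * \sum_(j < N.+1)
    (N.+1%:R^-1 * \sum_(i < N.+1) phi m%:R r (x i - x j)))%:E)%E.
Proof.
move=> r0; rewrite /energy.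
have mphi (y : 'rV[R]_n) :
    measurable_fun setT (fun z : X => phi m%:R r ((z : 'rV[R]_n) - y)).
  by apply/measurable_EFinP; exact: phi_shift_measurable.
under eq_integral => y _.
  rewrite (@uniform_measure_integral _ X R N x
    (fun z => phi m%:R r ((z : 'rV[R]_n) - y)))//; last first.
    by move=> z; exact: phi_ge0.
  over.
apply: (@uniform_measure_integral _ X R N x
  (fun y => N.+1%:R^-1 *
    \sum_(i < N.+1) phi m%:R r (x i - (y : 'rV[R]_n)))).
  by move=> y; rewrite mulr_ge0// sumr_ge0// => i _; exact: phi_ge0.
apply: measurable_funM => //; apply: measurable_sum => i.
apply: (eq_measurable_fun (fun y : X => phi m%:R r ((y : 'rV[R]_n) - x i))).
  by move=> y _; rewrite -(phiN (y - x i) r0) opprB.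
exact: mphi.
Qed.

Lemma energy_le1 (mu : probability X R) r : 0 < r -> (energy m%:R r mu <= 1)%E.
Proof.
move=> r0.
have c1 : (\int[mu]_y (cst 1%E y) = 1)%E.
  by rewrite integral_cst// mul1e; exact: probability_setT.
rewrite -[leRHS]c1; apply: ge0_le_integralT => y.
  by apply: integral_ge0 => z _; rewrite lee_fin phi_ge0.
rewrite -[leRHS]c1; apply: ge0_le_integralT => z; rewrite lee_fin ?phi_ge0//.
exact: phi_le1.
Qed.

(** Positivity of the infimum matters because the capacity is defined by a real
    inverse, which would be 0 for a vanishing infimum. *)
Lemma energy_inf_gt0 F r : compact F -> 0 < r ->
  exists2 e : R, 0 < e & (e%:E <= ereal_inf [set energy m%:R r mu | mu in
    [set mu : probability X R | mu (~` F) = 0%E]])%E.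
Proof.
move=> cF r0; have [D D0 FD] := compact_enorm_bounded cF.
have M0 : 0 < Num.max r (2 * D) by rewrite lt_max r0.
pose e := (r / Num.max r (2 * D)) ^+ m.
have e0 : 0 < e by rewrite exprn_gt0// divr_gt0.
have T0 : 0 < 3 ^+ m :> R by rewrite exprn_gt0.
exists ((3 ^+ m)^-1 * e); first by rewrite mulr_gt0// invr_gt0.
apply: le_ereal_inf_tmp => _ [mu /= muF <-].
have [N [x [w [Fx w0 w1 hE]]]] := energy_discretization m cF muF r0.
rewrite EFinM lee_pdivrMl//; apply: (le_trans _ hE); rewrite lee_fin.
have -> : e = \sum_i \sum_j w i * w j * e.
  under eq_bigr do rewrite -mulr_suml -mulr_sumr w1 mulr1.
  by rewrite -mulr_suml w1 mul1r.
apply: ler_sum => i _; apply: ler_sum => j _; rewrite ler_wpM2l ?mulr_ge0//.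
have M1 : 0 < Num.max r (enorm (x i - x j)) by rewrite lt_max r0.
rewrite phiE// lerXn2r ?nnegrE//; [exact/ltW/divr_gt0|exact/ltW/divr_gt0|].
rewrite ler_pM2l// lef_pV2 ?posrE// ge_max le_max lexx/= le_max.
apply/orP; right; apply: le_trans (enormB _ _) _.
by rewrite mulr2n mulrDl mul1r lerD// FD.
Qed.

Lemma capacity_ge F r N (x : nat -> 'rV[R]_n) (e : R) :
  compact F -> 0 < r -> (forall i, F (x i)) -> 0 < e ->
  \sum_(j < N.+1) \sum_(i < N.+1) phi m%:R r (x i - x j) <= N.+1%:R ^+ 2 * e ->
  e^-1 <= capacity m%:R r F.
Proof.
move=> cF r0 Fx e0 he.
have [e1 e10] := energy_inf_gt0 cF r0.
rewrite /capacity; set I := ereal_inf _ => e1I.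
have Ie : (I <= e%:E)%E.
  apply: ge_ereal_inf; exists (energy m%:R r (@uniform_measure _ X R N x)).
    by exists (@uniform_measure _ X R N x) => //=; exact: uniform_measure_setC.
  rewrite uniform_energy// lee_fin -mulr_sumr mulrA -invfM -expr2.
  by rewrite ler_pdivrMl ?exprn_gt0.
have fI : I \is a fin_num.
  rewrite fin_numElt (lt_le_trans _ e1I) ?ltNyr//=.
  by rewrite (le_lt_trans Ie) ?ltry.
move: Ie e1I; rewrite -(fineK fI) !lee_fin => Ie e1I.
by rewrite lef_pV2 ?posrE// (lt_le_trans e10).
Qed.

(** The infimum defining the capacity is then less than [r ^ t], and a measure of
    energy less than [r ^ t] can be discretised. *)
Lemma capacity_exponent_gt F r (t : R) : F !=set0 -> compact F -> 0 < r < 1 ->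
  t < ln (capacity m%:R r F) / - ln r ->
  exists N (x : 'I_N -> 'rV[R]_n) (w : 'I_N -> R),
    [/\ forall i, F (x i), forall i, 0 <= w i, \sum_i w i = 1 &
      \sum_i \sum_j w i * w j * phi m%:R r (x i - x j) <= 3 ^+ m * r `^ t].
Proof.
move=> [x0 Fx0] cF /andP[r0 r1]; rewrite /capacity; set I := ereal_inf _ => ht.
have I1 : (I <= 1)%E.
  apply: ge_ereal_inf; exists (energy m%:R r (@uniform_measure _ X R 0 (fun=> x0))).
    by exists (@uniform_measure _ X R 0 (fun=> x0)) => //=; exact: uniform_measure_setC.
  exact: energy_le1.
have [e1 e10] := energy_inf_gt0 cF r0; rewrite -/I => e1I.
have fI : I \is a fin_num.
  rewrite fin_numElt (lt_le_trans _ e1I) ?ltNyr//=.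
  by rewrite (le_lt_trans I1) ?ltry.
have I0 : 0 < fine I by rewrite -lte_fin fineK// (lt_le_trans _ e1I).
have lr : 0 < - ln r by rewrite oppr_gt0 ln_lt0// r0.
have : (I < (r `^ t)%:E)%E.
  rewrite -(fineK fI) lte_fin; move: ht; rewrite ltr_pdivlMr// lnV ?posrE//.
  by rewrite mulrN ltrN2 -ln_powR ltr_ln// posrE powR_gt0.
move=> /ereal_inf_lt[_ [mu /= muF <-] hmu].
have [N [x [w [Fx w0 w1 hE]]]] := energy_discretization m cF muF r0.
exists N, x, w; split=> //; rewrite -lee_fin (le_trans hE)// EFinM.
by rewrite lee_pmul2l ?ltW// lte_fin exprn_gt0.
Qed.

End Capacity.

(** * Covering numbers and upper limits *)

Section CoveringNumber.
Context {R : realType} {n : nat}.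
Implicit Types (F K : set 'rV[R]_n) (c : 'rV[R]_n) (r : R).

Lemma diam_le_dist (A : set 'rV[R]_n) r x y :
  diam A = r%:E -> A x -> A y -> enorm (x - y) <= r.
Proof.
move=> dA Ax Ay; rewrite -lee_fin -dA; apply: ereal_sup_ubound.
by exists (x, y).
Qed.

(** Covers consist of sets of diameter exactly [r]; closed balls realise it as soon
    as the space is not a point. *)
Lemma diam_ball c r : (0 < n)%N -> 0 <= r ->
  diam [set y | enorm (y - c) <= r / 2] = r%:E.
Proof.
case: n c => // k c _ r0; apply/eqP; rewrite eq_le; apply/andP; split.
  apply: ge_ereal_sup => _ [[x y] [/= xc yc] <-]; rewrite lee_fin.
  apply: le_trans (enorm_triangle c _ _) _; rewrite (enormC c).
  by rewrite (splitr r) lerD.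
pose e : 'rV[R]_k.+1 := delta_mx 0 0.
have e1 : enorm e = 1.
  rewrite /enorm /dotv (bigD1 ord0)//= big1 => [|i i0].
    by rewrite mxE !eqxx mulr1 addr0 sqrtr1.
  by rewrite mxE (negPf i0) andbF mulr0.
apply: ereal_sup_ubound; exists (c + (r / 2) *: e, c - (r / 2) *: e) => /=.
  have r2 : `|r / 2| <= r / 2 by rewrite ger0_norm// divr_ge0.
  by split; rewrite addrAC subrr add0r ?enormN enormZ e1 mulr1.
rewrite opprD opprK addrACA subrr add0r -scalerDl -splitr enormZ e1 mulr1.
by rewrite ger0_norm.
Qed.

Lemma covering_number_le F r k (c : 'I_k -> 'rV[R]_n) : (0 < n)%N -> 0 <= r ->
  (forall x, F x -> exists i, enorm (x - c i) <= r / 2) ->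
  covering_number r F <= k%:R.
Proof.
move=> n0 r0 hc; apply: ge_inf.
  by exists 0 => _ [j _ <-].
exists k => //; exists (fun i => [set y | enorm (y - c i) <= r / 2]); split.
  by move=> i; exact: diam_ball.
by move=> x /hc[i xi]; exists i.
Qed.

Lemma le_covering_number K r b : (0 < n)%N -> compact K -> 0 < r ->
  (forall k (A : 'I_k -> set 'rV[R]_n), (forall i, diam (A i) = r%:E) ->
    K `<=` \bigcup_i A i -> b <= k%:R) ->
  b <= covering_number r K.
Proof.
move=> n0 cK r0 hb; apply: lb_le_inf; last first.
  by move=> _ [k [A [dA KA]] <-]; exact: hb KA.
have r2 : 0 < r / 2 by rewrite divr_gt0.
have [k [c [_ hc]]] := compact_net cK r2.
exists k%:R, k => //; exists (fun i => [set y | enorm (y - c i) <= r / 2]); split.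
  by move=> i; apply: diam_ball => //; exact: ltW.
by move=> x /hc[i /ltW xi]; exists i.
Qed.

Lemma covering_number_ge1 K r : (0 < n)%N -> compact K -> K !=set0 -> 0 < r ->
  1 <= covering_number r K.
Proof.
move=> n0 cK [x Kx] r0; apply: le_covering_number => // -[|k] A _ KA.
  by have [[]] := KA x Kx.
by rewrite ler1n.
Qed.

End CoveringNumber.

Section LimitSuperior.
Context {R : realType}.
Implicit Types f g : R -> R.

Lemma limf_esup_le_add f g :
  (forall e, 0 < e -> \forall r \near 0^'+, f r <= g r + e) ->
  (limf_esup (fun r => (f r)%:E) 0^'+ <= limf_esup (fun r => (g r)%:E) 0^'+)%E.
Proof.
move=> fg; apply/lee_addgt0Pr => e /fg fge.
rewrite -leeBlDr//; rewrite [leRHS]limf_esupE.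
apply: le_ereal_inf_tmp => _ [A A0 <-]; rewrite leeBlDr//.
rewrite limf_esupE; apply: ge_ereal_inf; eexists.
  by exists (A `&` [set r | f r <= g r + e]); first exact: filterI.
apply: ge_ereal_sup => _ [r [Ar /= fr] <-].
apply: (@le_trans _ _ ((g r)%:E + e%:E)%E); first by rewrite -EFinD lee_fin.
by rewrite leeD2r//; apply: ereal_sup_ubound; exists r.
Qed.

Lemma limf_esup_gt f (t : R) :
  (t%:E < limf_esup (fun r => (f r)%:E) 0^'+)%E ->
  forall d, 0 < d -> exists2 r, 0 < r < d & t < f r.
Proof.
move=> tf d d0; pose A : set R := [set r | 0 < r < d].
have A0 : 0^'+ A.
  near=> r; apply/andP; split; near: r; [exact: nbhs_right_gt|exact: nbhs_right_lt].
have : (t%:E < ereal_sup ((fun r => (f r)%:E) @` A))%E.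
  apply: lt_le_trans tf _; rewrite limf_esupE; apply: ereal_inf_lbound.
  by exists A.
by move=> /ereal_sup_gt[_ [r rd <-]]; rewrite lte_fin => ?; exists r.
Unshelve. all: by end_near. Qed.

Lemma le_limf_esup f (t : R) :
  (forall d, 0 < d -> exists2 r, 0 < r < d & t <= f r) ->
  (t%:E <= limf_esup (fun r => (f r)%:E) 0^'+)%E.
Proof.
move=> tf; rewrite limf_esupE; apply: le_ereal_inf_tmp => _ [A A0 <-].
have [d /= d0 dA] := A0; have [r /andP[r0 rd] tr] := tf d d0.
apply: (@le_trans _ _ (f r)%:E); first by rewrite lee_fin.
apply: ereal_sup_ubound; exists r => //; apply: dA => //=.
by rewrite sub0r normrN gtr0_norm.
Qed.

(** The exponential dominates its quadratic Taylor term, which dominates any affine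
    function far enough. *)
Lemma affine_le_expR (a b e : R) : 0 < a -> 0 <= b -> 0 < e ->
  exists2 l0, 0 < l0 & forall l, l0 <= l -> a * (l + b) <= expR (e * l).
Proof.
move=> a0 b0 e0; exists (b + 8 * a / e ^+ 2).
  by rewrite ltr_wpDl// divr_gt0 ?mulr_gt0 ?exprn_gt0.
move=> l hl; have e2 : 0 < e ^+ 2 by rewrite exprn_gt0.
have c0 : 0 < 8 * a / e ^+ 2 by rewrite divr_gt0 ?mulr_gt0.
have h1 : b <= l by lra.
have l0 : 0 < l by lra.
have h2 : 8 * a <= e ^+ 2 * l.
  by rewrite [leRHS]mulrC -ler_pdivrMr//; lra.
have -> : e * l = e * l / 2 + e * l / 2 by lra.
rewrite expRD -expr2; set X := expR _.
have hX : 1 + e * l / 2 <= X by exact: expR_ge1Dx.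
have el : 0 < e * l by rewrite mulr_gt0.
have : (e * l / 2) ^+ 2 <= X ^+ 2 by rewrite lerXn2r ?nnegrE; lra.
apply: le_trans.
apply: (@le_trans _ _ (a * (2 * l))); first by rewrite ler_pM2l//; lra.
have -> : (e * l / 2) ^+ 2 = (e ^+ 2 * l) * l / 4 by field.
have : 8 * a * l <= e ^+ 2 * l * l by rewrite ler_pM2r.
lra.
Qed.

End LimitSuperior.

(** * Projections onto every subspace *)

Section DyadicShells.
Context {m L : nat}.
Implicit Types z : {ffun 'I_m -> 'I_L.+1}.

Definition cells_close (k : nat) z z' : bool :=
  [forall i, (z i < z' i + 2 ^ k)%N && (z' i < z i + 2 ^ k)%N].

Lemma card_cells_close k z : (#|[set z' | cells_close k z z']%SET| <= (2 ^ k.+1) ^ m)%N.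
Proof.
pose t z' : {ffun 'I_m -> 'I_(2 ^ k.+1).-1.+1} :=
  [ffun i => inord (z' i + 2 ^ k - z i)].
have pE : ((2 ^ k.+1).-1.+1 = 2 ^ k.+1)%N by rewrite prednK// expn_gt0.
have tE z' i : cells_close k z z' -> t z' i = (z' i + 2 ^ k - z i)%N :> nat.
  move=> /forallP/(_ i)/andP[h1 h2]; rewrite ffunE inordK// pE expnS; lia.
rewrite -(card_in_imset (f := t)).
  apply: leq_trans (max_card _) _.
  by rewrite card_ffun !card_ord pE.
move=> z1 z2; rewrite !inE => c1 c2 t12; apply/ffunP => i; apply/val_inj => /=.
have := congr1 (fun g : {ffun 'I_m -> 'I_(2 ^ k.+1).-1.+1} => nat_of_ord (g i)) t12.
rewrite /= !tE//.
by move: c1 c2 => /forallP/(_ i)/andP[h1 h2] /forallP/(_ i)/andP[h3 h4]; lia.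
Qed.

End DyadicShells.

Section UpperBound.
Context {R : realType} {n m : nat} {le_mn : (m <= n)%N}.
Local Notation G := (Grassmannian R le_mn).

(** In the coordinates of the adapted basis, cut [V] into cells of side
    [h = r / (2 n m)] and choose a point of [F] above each of the [N] cells met by the
    projection.  Balls of radius [r / 2] around the projected points cover, so the
    covering number is at most [N].  The uniform measure on the chosen points has
    energy at most a constant times [K.+1 / N]: the points whose cell is at distance
    about [2 ^ k h] from a given cell number at most a constant times [2 ^ (k m)],
    while the kernel is there at most a constant times [2 ^ (- k m)], so each of the
    [K.+1] dyadic shells contributes a bounded amount. *)
Lemma covering_number_le_capacity (V : G) (F : set 'rV[R]_n) (D r : R) K :
  (0 < m)%N -> F !=set0 -> compact F -> (forall x, F x -> enorm x <= D) ->
  0 < r -> 4 * n%:R * m%:R * D / r < 2 ^+ K ->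
  covering_number r (orthproj V @` F) <=
    (16 * n%:R * m%:R) ^+ m * K.+1%:R * capacity m%:R r F.
Proof.
move=> m0 [x0 Fx0] cF FD r0 hK.
have n0 : (0 < n)%N := leq_trans m0 le_mn.
have [A [f [AV Af A1 AE]]] := adapted_basis (eqP (dim_subspace V)).
have n1 : 1 <= n%:R :> R by rewrite ler1n.
have m1 : 1 <= m%:R :> R by rewrite ler1n.
have nm1 : 1 <= n%:R * m%:R :> R by rewrite mulr_ege1.
have D0 : 0 <= D := le_trans (enorm_ge0 x0) (FD x0 Fx0).
pose h := r / (2 * n%:R * m%:R).
have h0 : 0 < h by rewrite divr_gt0// -mulrA mulr_gt0//; lra.
have hE : h * (2 * (n%:R * m%:R)) = r by rewrite /h; field; rewrite !gt_eqF//; lra.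
pose p x : 'rV[R]_n := orthproj V x.
pose u x i : R := p x 0 (f i) + D.
have pD x i : F x -> `|p x 0 i| <= D.
  move=> Fx; apply: le_trans (coord_le_enorm _ _) _.
  exact: le_trans (enorm_orthproj _ _) (FD _ Fx).
have u0 x i : F x -> 0 <= u x i.
  by move=> Fx; have := pD x (f i) Fx; rewrite ler_norml /u => /andP[]; lra.
have uD x i : F x -> u x i <= 2 * D.
  by move=> Fx; have := pD x (f i) Fx; rewrite ler_norml /u => /andP[]; lra.
(* The shift by [D] makes all coordinates nonnegative, so that cell indices are
   natural numbers bounded by [L]. *)
pose L := Num.truncn (2 * D / h).
have hL : (L < 2 ^ K)%N.
  rewrite -(ltr_nat R) natrX; apply: le_lt_trans hK.
  have /andP[hL _] : L%:R <= 2 * D / h < L.+1%:R.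
    by apply: truncn_itv; rewrite divr_ge0 ?mulr_ge0// ltW.
  apply: le_trans hL _; rewrite le_eqVlt; apply/orP; left; apply/eqP.
  by rewrite /h; field; rewrite !gt_eqF//; lra.
pose z x : {ffun 'I_m -> 'I_L.+1} := [ffun i => inord (Num.truncn (u x i / h))].
have zE x i : F x -> (z x i)%:R * h <= u x i < ((z x i)%:R + 1) * h.
  move=> Fx; have uh : 0 <= u x i / h by rewrite divr_ge0 ?u0// ltW.
  have /andP[t1 t2] := truncn_itv uh.
  rewrite ffunE inordK.
    by rewrite -ler_pdivlMr// t1/= -ltr_pdivrMr// natr1.
  rewrite ltnS -(ler_nat R); rewrite ler_nat; apply: le_truncn.
  by rewrite ler_pM2r ?invr_gt0// uD.
pose Z : {set {ffun 'I_m -> 'I_L.+1}} := [set y | `[< exists2 x, F x & z x = y >]]%SET.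
(* A chosen point of [F] above the cell [y]; [x0] is a dummy value for empty
   cells. *)
pose rep y := xget x0 [set x | F x /\ z x = y].
have repP y : y \in Z -> F (rep y) /\ z (rep y) = y.
  rewrite inE => /asboolP[x Fx zx]; rewrite /rep.
  by case: xgetP => [w -> //|/(_ x)]; case.
have FZ x : F x -> z x \in Z by move=> Fx; rewrite inE; apply/asboolP; exists x.
have cover x y : F x -> F y -> z x = z y -> enorm (p x - p y) <= r / 2.
  move=> Fx Fy zxy.
  have uu i : `|p x 0 (f i) - p y 0 (f i)| <= h.
    have /andP[a1 a2] := zE x i Fx; have /andP[b1 b2] := zE y i Fy.
    move: a1 a2 b1 b2; rewrite zxy /u ler_norml; lra.
  have dV : p x - p y \in V by rewrite rpredB// orthproj_in.
  apply: (@le_trans _ _ (n%:R * (m%:R * h))); last by rewrite -hE; lra.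
  apply: enorm_le_coord => [|j]; first by rewrite mulr_ge0// ltW.
  rewrite (AE _ dV) summxE mulr_natl -[X in _ *+ X]card_ord -sumr_const.
  apply: le_trans (ler_norm_sum _ _ _) _; apply: ler_sum => i _.
  rewrite !mxE normrM -[leRHS]mulr1; apply: ler_pM => //.
(* Different cells may be adjacent, so cells at distance at least [2 ^ k] only
   guarantee [2 ^ k - 1] sides; the constant 8 absorbs this loss. *)
have sep k x y : F x -> F y -> ~~ cells_close k (z x) (z y) ->
    2 ^+ k.+1 * r <= (8 * n%:R * m%:R) * Num.max r (enorm (x - y)).
  move=> Fx Fy; rewrite negb_forall => /existsP[i nc].
  have M1 : r <= Num.max r (enorm (x - y)) by rewrite le_max lexx.
  have M2 : enorm (x - y) <= Num.max r (enorm (x - y)) by rewrite le_max lexx orbT.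
  move: (Num.max _ _) M1 M2 => M M1 M2.
  case: k nc => [|k] nc.
    apply: (@le_trans _ _ (8 * r)); first by rewrite ler_pM2r//; lra.
    rewrite -!mulrA ler_pM2l// mulrA; apply: (le_trans M1).
    by rewrite ler_peMl// (le_trans (ltW r0)).
  apply: (@le_trans _ _ (8 * n%:R * m%:R * enorm (x - y))); last first.
    by rewrite ler_pM2l// -mulrA mulr_gt0//; lra.
  rewrite -hE.
  suff : 2 ^+ k * h <= enorm (x - y).
    move=> hq; rewrite !exprS.
    rewrite (_ : 2 * _ * _ = 8 * n%:R * m%:R * (2 ^+ k * h)); last by ring.
    by rewrite ler_wpM2l// !mulr_ge0.
  have d1 : `|u x i - u y i| <= enorm (x - y).
    apply: le_trans (enorm_orthproj V _); apply: le_trans (coord_le_enorm _ (f i)).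
    by rewrite linearB /= !mxE /u opprD addrACA subrr addr0.
  apply: le_trans d1.
  have /andP[a1 a2] := zE x i Fx; have /andP[b1 b2] := zE y i Fy.
  have k1 : 1 <= 2 ^+ k :> R by rewrite exprn_ege1//; lra.
  move: nc; rewrite negb_and -!leqNgt -!(ler_nat R) !natrD !natrX exprS.
  move: (2 ^+ k) k1 => q k1 /orP[nc|nc].
    rewrite (le_trans _ (ler_norm _))//.
    have : (z y i)%:R * h + 2 * q * h <= (z x i)%:R * h by rewrite -mulrDl ler_pM2r.
    have : h <= q * h by rewrite ler_peMl// ltW.
    lra.
  rewrite distrC (le_trans _ (ler_norm _))//.
  have : (z x i)%:R * h + 2 * q * h <= (z y i)%:R * h by rewrite -mulrDl ler_pM2r.
  have : h <= q * h by rewrite ler_peMl// ltW.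
  lra.
have shells x y : F x -> F y -> phi m%:R r (x - y) <=
    \sum_(k < K.+1) (8 * n%:R * m%:R) ^+ m / (2 ^+ k) ^+ m *
      (cells_close k (z x) (z y))%:R.
  move=> Fx Fy; have cK : cells_close K (z x) (z y).
    apply/forallP => i; have := ltn_ord (z x i); have := ltn_ord (z y i); lia.
  have exk : exists k, cells_close k (z x) (z y) by exists K.
  case: (ex_minnP exk) => k ck kmin.
  have kK : (k < K.+1)%N by rewrite ltnS kmin.
  have t0 j : 0 <= (8 * n%:R * m%:R) ^+ m / (2 ^+ j) ^+ m *
      (cells_close j (z x) (z y))%:R :> R.
    by rewrite mulr_ge0// divr_ge0 ?exprn_ge0// !mulr_ge0.
  rewrite (bigD1 (Ordinal kK))//= ck mulr1 -[leLHS]addr0 lerD//; last first.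
    exact: sumr_ge0.
  have M0 : 0 < Num.max r (enorm (x - y)) by rewrite lt_max r0.
  have C0 : 0 <= 8 * n%:R * m%:R / 2 ^+ k :> R.
    by rewrite divr_ge0 ?exprn_ge0 ?mulr_ge0.
  rewrite phiE// -expr_div_n lerXn2r ?nnegrE//; first exact/ltW/divr_gt0.
  rewrite ler_pdivrMr// mulrAC ler_pdivlMr ?exprn_gt0// mulrC.
  move: kK C0 => _ _; case: k ck kmin => [|k] ck kmin.
    rewrite expr0 mul1r; apply: (@le_trans _ _ (Num.max r (enorm (x - y)))).
      by rewrite le_max lexx.
    by rewrite ler_peMl ?ltW//; lra.
  apply: sep => //; apply/negP => /kmin; lia.
pose c2 : R := (16 * n%:R * m%:R) ^+ m * K.+1%:R.
have rowsum x : F x -> \sum_(y in Z) phi m%:R r (x - rep y) <= c2.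
  move=> Fx; apply: (@le_trans _ _ (\sum_(y in Z) \sum_(k < K.+1)
      (8 * n%:R * m%:R) ^+ m / (2 ^+ k) ^+ m * (cells_close k (z x) y)%:R)).
    apply: ler_sum => y yZ; have [Fy zy] := repP y yZ.
    by rewrite -{2}zy; exact: shells.
  have -> : c2 = \sum_(k < K.+1) (16 * n%:R * m%:R) ^+ m.
    by rewrite sumr_const card_ord /c2 mulr_natr.
  rewrite exchange_big/=.
  apply: ler_sum => k _; rewrite -mulr_sumr.
  have cnt : \sum_(y in Z) (cells_close k (z x) y)%:R <= (2 ^+ k.+1) ^+ m :> R.
    apply: (@le_trans _ _ (#|[set y | cells_close k (z x) y]%SET|%:R)).
      rewrite -sum1_card natr_sum [leLHS]big_mkcond [leRHS]big_mkcond/=.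
      by apply: ler_sum => y _; rewrite !inE; case: ifP => //; case: cells_close.
    by rewrite -!natrX ler_nat card_cells_close.
  apply: le_trans (ler_wpM2l _ cnt) _.
    by rewrite divr_ge0 ?exprn_ge0 ?mulr_ge0.
  rewrite le_eqVlt; apply/orP; left; apply/eqP.
  rewrite -expr_div_n -exprMn exprS; congr (_ ^+ _).
  by field; rewrite gt_eqF ?exprn_gt0.
have Z0 : z x0 \in Z := FZ x0 Fx0.
have : exists N, #|Z| = N.+1.
  by exists #|Z|.-1; rewrite prednK//; apply/card_gt0P; exists (z x0).
case=> N ZN.
pose e i := nth (z x0) (enum Z) i.
have eZ i : e i \in Z.
  rewrite /e; have [iZ|iZ] := ltnP i #|Z|; last by rewrite nth_default// -cardE.
  by rewrite -mem_enum mem_nth// -cardE.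
have sumZ (g : {ffun 'I_m -> 'I_L.+1} -> R) :
    \sum_(i < N.+1) g (e i) = \sum_(y in Z) g y.
  have sZ : size (enum Z) = N.+1 by rewrite -cardE.
  transitivity (\sum_(y <- enum Z) g y); last by rewrite big_enum.
  by rewrite (big_nth (z x0)) sZ big_mkord.
have c20 : 0 < c2 by rewrite mulr_gt0// exprn_gt0//; lra.
have capN : N.+1%:R / c2 <= capacity m%:R r F.
  rewrite -invf_div; apply: (@capacity_ge R n m F r N (fun i => rep (e i))) => //.
  - by move=> i; case: (repP _ (eZ i)).
  - by rewrite divr_gt0.
  have -> : N.+1%:R ^+ 2 * (c2 / N.+1%:R) = \sum_(j < N.+1) c2.
    rewrite sumr_const card_ord -mulr_natl; field.
    by rewrite addr_eq0 -[X in _ == X]opprK gt_eqF// natr1.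
  apply: ler_sum => j _.
  apply: (@le_trans _ _ (\sum_(y in Z) phi m%:R r (rep (e j) - rep y))).
    rewrite -(sumZ (fun y => phi m%:R r (rep (e j) - rep y))).
    by apply: ler_sum => i _; rewrite -phiN// opprB.
  by apply: rowsum; case: (repP _ (eZ j)).
apply: (@le_trans _ _ N.+1%:R); last by rewrite mulrC -ler_pdivrMr.
apply: (@covering_number_le R n _ r N.+1 (fun i => p (rep (e i)))) => //.
  exact: ltW.
move=> _ [x Fx <-].
have iZ : (index (z x) (enum Z) < N.+1)%N by rewrite -ZN cardE index_mem mem_enum FZ.
exists (Ordinal iZ); rewrite /= /e nth_index ?mem_enum ?FZ//.
have [Fr zr] := repP _ (FZ x Fx).
by apply: cover.
Qed.

End UpperBound.

Lemma shell_cost (R : realFieldType) (a l q c k : R) : 0 < q -> 0 < c ->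
  k <= (a + l) / q + 1 -> c * (k + 1) <= c / q * (l + (a + 2 * q)).
Proof.
move=> q0 c0 hk; rewrite -mulrA ler_pM2l//.
rewrite (_ : q^-1 * _ = (a + l) / q + 1 + 1); last by field; rewrite gt_eqF.
by rewrite lerD2r.
Qed.

Section UpperBound.
Context {R : realType} {n m : nat} {le_mn : (m <= n)%N}.
Local Notation G := (Grassmannian R le_mn).

Lemma orthproj_continuous (V : {vspace 'rV[R]_n}) : continuous (orthproj V).
Proof.
move=> x; apply/(@cvg_ballP R 'rV[R]_n 'rV[R]_n _ (nbhs_filter x)) => e e0.
have : nbhs x [set y | enorm (y - x) < e].
  by apply: open_nbhs_nbhs; split; [exact: open_eball|rewrite /= subrr enorm0].
apply: (@filterS _ _ (nbhs_filter x)) => y /= yx.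
rewrite mx_norm_ball /ball_ /= -linearB/=.
apply: le_lt_trans (mx_norm_le_enorm _) _; apply: le_lt_trans (enorm_orthproj _ _) _.
by rewrite enormC.
Qed.

Lemma compact_orthproj (V : {vspace 'rV[R]_n}) F :
  compact F -> compact (orthproj V @` F).
Proof.
move=> cF; apply: continuous_compact => //.
exact/continuous_subspaceT/orthproj_continuous.
Qed.

(** The number of dyadic shells is of order [- ln r], so that the extra factor
    [K.+1] of [covering_number_le_capacity] is absorbed by any positive exponent. *)
Lemma upper_box_dim_orthproj_le (V : G) (F : set 'rV[R]_n) :
  (0 < m)%N -> F !=set0 -> compact F ->
  (upper_box_dim (orthproj V @` F) <= upper_box_dim_profile m%:R F)%E.
Proof.
move=> m0 F0 cF; apply: limf_esup_le_add => e e0.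
have n0 : (0 < n)%N := leq_trans m0 le_mn.
have [D D0 FD] := compact_enorm_bounded cF.
have n1 : 1 <= n%:R :> R by rewrite ler1n.
have m1 : 1 <= m%:R :> R by rewrite ler1n.
pose X : R := 4 * n%:R * m%:R * D.
have X0 : 0 < X by rewrite mulr_gt0// -mulrA mulr_gt0// mulr_gt0//; lra.
have l2 : 0 < ln 2 :> R by rewrite ln_gt0//; lra.
pose c : R := (16 * n%:R * m%:R) ^+ m.
have c0 : 0 < c by rewrite exprn_gt0// -mulrA mulr_gt0// mulr_gt0//; lra.
have [l0 l00 hl] := @affine_le_expR R (c / ln 2) (`|ln X| + 2 * ln 2) e
  (divr_gt0 c0 l2) (addr_ge0 (normr_ge0 _) (mulr_ge0 (ler0n R 2) (ltW l2))) e0.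
near=> r.
have r0 : 0 < r by near: r; exact: nbhs_right_gt.
have rl : r < expR (- l0) by near: r; apply: nbhs_right_lt; exact: expR_gt0.
pose l := - ln r.
have rE : r = expR (- l) by rewrite /l opprK lnK.
have ll0 : l0 < l by move: rl; rewrite {1}rE ltr_expR; lra.
have lp : 0 < l by lra.
pose K := (Num.truncn ((`|ln X| + l) / ln 2)).+1.
have KE : (`|ln X| + l) / ln 2 < K%:R /\ K%:R <= (`|ln X| + l) / ln 2 + 1.
  have /andP[a b] := @truncn_itv R ((`|ln X| + l) / ln 2)
    (divr_ge0 (addr_ge0 (normr_ge0 _) (ltW lp)) (ltW l2)).
  by split=> //; rewrite /K -natr1 lerD2r.
have hK : 4 * n%:R * m%:R * D / r < 2 ^+ K.
  rewrite -/X -ltr_ln ?posrE ?exprn_gt0 ?divr_gt0// ln_div ?posrE// lnXn// -/l.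
  rewrite -[ln 2 *+ K]mulr_natl -ltr_pdivrMr//; apply: le_lt_trans KE.1.
  by rewrite ler_pM2r ?invr_gt0// -/l lerD2r ler_norm.
have := covering_number_le_capacity V m0 F0 cF FD r0 hK; rewrite -/c.
have N1 : 1 <= covering_number r (orthproj V @` F).
  apply: covering_number_ge1 => //; first exact: compact_orthproj.
  by case: F0 => x Fx; exists (orthproj V x), x.
move: (covering_number _ _) (capacity _ _ _) N1 => N C N1 hN.
have cK : c * K.+1%:R <= expR (e * l).
  by apply: le_trans (hl l (ltW ll0)); rewrite -natr1; apply: shell_cost; rewrite ?KE.2.
have cK0 : 0 < c * K.+1%:R by rewrite mulr_gt0.
have C0 : 0 < C by rewrite -(pmulr_rgt0 _ cK0) (lt_le_trans ltr01)// (le_trans N1).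
rewrite -/l -[e](@mulfK _ l) ?gt_eqF// -mulrDl ler_pM2r ?invr_gt0//.
rewrite -ler_expR expRD !lnK ?posrE//; last exact: lt_le_trans N1.
by apply: le_trans hN _; rewrite mulrC ler_pM2l.
Unshelve. all: by end_near. Qed.

Lemma packing_dim_orthproj_le (V : G) (E : set 'rV[R]_n) : (0 < m)%N ->
  (packing_dim (orthproj V @` E) <= packing_dim_profile m%:R E)%E.
Proof.
move=> m0; apply: le_ereal_inf_tmp => _ [F [Fc EF] <-].
apply: ge_ereal_inf; eexists.
  exists (fun i => orthproj V @` F i) => //; split.
    move=> i; have [[x Fx] cF] := Fc i; split; last exact: compact_orthproj.
    by exists (orthproj V x), x.
  by move=> _ [x /EF[i _ Fx] <-]; exists i => //; exists x.
apply: ge_ereal_sup => _ [i _ <-].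
apply: le_trans (_ : _ <= upper_box_dim_profile m%:R (F i))%E _.
  by have [F0 cF] := Fc i; exact: upper_box_dim_orthproj_le.
by apply: ereal_sup_ubound; exists i.
Qed.

End UpperBound.

(** * Projections onto almost every subspace *)

(** The Cauchy-Schwarz inequality for weights of total mass 1 grouped in [p] classes,
    obtained from the variance-like sum [\sum_b (p W_b - 1) ^ 2]. *)
Lemma sum_collisions_ge (R : realFieldType) (N p : nat) (a : 'I_N -> 'I_p)
    (w : 'I_N -> R) : \sum_i w i = 1 ->
  1 <= p%:R * \sum_i \sum_j w i * w j * (a i == a j)%:R.
Proof.
move=> w1; pose W b := \sum_(i | a i == b) w i.
have W1 : \sum_b W b = 1 by rewrite -w1 [RHS](partition_big a predT).
have -> : \sum_i \sum_j w i * w j * (a i == a j)%:R = \sum_b W b ^+ 2.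
  rewrite (partition_big a predT)//=; apply: eq_bigr => b _.
  rewrite expr2 /W mulr_suml; apply: eq_bigr => i /eqP ai.
  rewrite mulr_sumr [RHS]big_mkcond; apply: eq_bigr => j _.
  by rewrite ai eq_sym; case: eqP; rewrite ?mulr1 ?mulr0.
have p0 : (0 < p)%N.
  case: p a W W1 => // a W; rewrite big_ord0 => /eqP.
  by rewrite eq_sym oner_eq0.
have : 0 <= \sum_b (p%:R * W b - 1) ^+ 2 by apply: sumr_ge0 => b _; exact: sqr_ge0.
have -> : \sum_b (p%:R * W b - 1) ^+ 2 = p%:R * (p%:R * (\sum_b W b ^+ 2) - 1).
  have E b : (p%:R * W b - 1) ^+ 2 =
    p%:R ^+ 2 * W b ^+ 2 + (- 2 * p%:R) * W b + 1 by ring.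
  under eq_bigr do rewrite E.
  rewrite !big_split/= -!mulr_sumr W1 sumr_const card_ord.
  ring.
by rewrite pmulr_rge0 ?ltr0n// subr_ge0.
Qed.

Section LowerBound.
Context {R : realType} {n m : nat} {le_mn : (m <= n)%N}.
Local Notation G := (Grassmannian R le_mn).
Hypothesis n0 : (0 < n)%N.

(** Points assigned to the same set of a cover have projections within [r], so that
    the mass of pairs of points with close projections is at least 1 over the number
    of sets. *)
Lemma covering_number_ge_collisions (V : G) (F K : set 'rV[R]_n) (r b : R) N
    (x : 'I_N -> 'rV[R]_n) (w : 'I_N -> R) :
  compact K -> orthproj V @` F `<=` K -> 0 < r -> 0 < b ->
  (forall i, F (x i)) -> (forall i, 0 <= w i) -> \sum_i w i = 1 ->
  \sum_(p : 'I_N * 'I_N) w p.1 * w p.2 * \1_(slab (x p.1 - x p.2) r : set G) V <= b ->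
  b^-1 <= covering_number r K.
Proof.
move=> cK FK r0 b0 Fx w0 w1 hb; apply: le_covering_number => // k A dA KA.
have /choice[a aP] i : exists j, A j (orthproj V (x i)).
  by have [j _ Aj] := KA _ (FK _ (ex_intro2 _ _ (x i) (Fx i) erefl)); exists j.
have := sum_collisions_ge a w1 => h.
rewrite -div1r ler_pdivrMr//; apply: le_trans h _; rewrite ler_wpM2l//.
apply: le_trans hb; rewrite pair_big/=; apply: ler_sum => -[i j] _ /=.
rewrite ler_wpM2l ?mulr_ge0// indicE ler_nat.
case: eqP => // aij; rewrite mem_set// /slab /= linearB /=.
apply: diam_le_dist (dA (a i)) _ _; first exact: aP.
by rewrite aij; exact: aP.
Qed.

Variable gamma : probability (borelType G) R.
Hypothesis gammaP : orthogonally_invariant gamma.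

(** By [slab_measure_le], the mass of the pairs of points with projections within [r]
    is on average at most a constant times the energy, hence at most [r ^ t] outside
    a set of subspaces controlled by Markov's inequality. *)
Lemma small_exceptional_set (F : set 'rV[R]_n) (r t t' : R) :
  F !=set0 -> compact F -> 0 < r < 1 ->
  t' < ln (capacity m%:R r F) / - ln r ->
  exists B : set G, [/\ measurable (B : set (borelType G)),
    fine (gamma B) <= @slab_const R n m * 3 ^+ m * r `^ (t' - t) &
    forall V, ~ B V -> forall K, compact K -> orthproj V @` F `<=` K ->
      t <= ln (covering_number r K) / - ln r].
Proof.
move=> F0 cF /[dup] r01 /andP[r0 r1] ht.
have [N [x [w [Fx w0 w1 hE]]]] := capacity_exponent_gt F0 cF r01 ht.
pose wp (p : 'I_N * 'I_N) := w p.1 * w p.2.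
pose S (p : 'I_N * 'I_N) : set (borelType G) := slab (x p.1 - x p.2) r.
have wp0 p : 0 <= wp p by rewrite mulr_ge0.
have mS p : measurable (S p) by exact: slab_measurable.
have rt0 : 0 < r `^ t by rewrite powR_gt0.
have [mB hB] := sum_indic_markov gamma (ltW rt0) wp0 mS.
exists [set V | r `^ t < \sum_p wp p * \1_(S p) V]; split=> //.
  rewrite powRB; last by apply/implyP => _; exact: lt0r_neq0.
  rewrite mulrA ler_pdivlMr// mulrC; apply: le_trans hB _.
  apply: (@le_trans _ _ (@slab_const R n m *
      \sum_i \sum_j w i * w j * phi m%:R r (x i - x j))).
    rewrite pair_big/= mulr_sumr; apply: ler_sum => p _.
    rewrite mulrCA ler_wpM2l//; exact: slab_measure_le.
  rewrite -mulrA ler_wpM2l//; exact: le_trans (slab_const_ge1 n0).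
move=> V /negP; rewrite -leNgt => hV K cK FK.
have lr : 0 < - ln r by rewrite oppr_gt0 ln_lt0// r0.
have h := covering_number_ge_collisions cK FK r0 rt0 Fx w0 w1 hV.
have rti : 0 < (r `^ t)^-1 by rewrite invr_gt0.
rewrite ler_pdivlMr// mulrN -ln_powR -lnV ?posrE// ler_ln ?posrE//.
exact: lt_le_trans h.
Qed.

(** The scales [r k] are chosen so small that the exceptional sets have measures
    tending to 0.  It suffices that infinitely many scales are good for [V], and the
    set of subspaces for which this fails is a countable union of sets each contained
    in exceptional sets of arbitrarily small measure.  The compact set [K] is
    quantified inside the exceptional set because later it comes from a cover that
    depends on [V]. *)
Lemma ae_upper_box_dim_orthproj_ge (F : set 'rV[R]_n) (t : R) :
  F !=set0 -> compact F -> (t%:E < upper_box_dim_profile m%:R F)%E ->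
  {ae gamma, forall V : G, forall K, compact K -> orthproj V @` F `<=` K ->
    (t%:E <= upper_box_dim K)%E}.
Proof.
move=> F0 cF tF.
have [t' tt' t'F] : exists2 t', t < t' & (t'%:E < upper_box_dim_profile m%:R F)%E.
  move: tF; case: (upper_box_dim_profile _ _) => [s||]//.
    rewrite lte_fin => ts; exists ((t + s) / 2); rewrite ?lte_fin; lra.
  by move=> _; exists (t + 1); rewrite ?ltry//; lra.
pose e := t' - t; have e0 : 0 < e by rewrite subr_gt0.
(* The first bound sends the scales to 0, the second one makes [r k ^ e] at most
   [1 / k.+1]. *)
pose d (k : nat) : R := Num.min (k.+2%:R^-1) (k.+1%:R^-1 `^ e^-1).
have d0 k : 0 < d k by rewrite lt_min invr_gt0 ltr0n/= powR_gt0// invr_gt0.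
have /choice[r rP] k : exists r, (0 < r < d k) /\
    t' < ln (capacity m%:R r F) / - ln r.
  by have [r rd hr] := limf_esup_gt t'F (d0 k); exists r.
have r0 k : 0 < r k by case: (rP k) => /andP[].
have rd1 k : r k < k.+2%:R^-1.
  by case: (rP k) => /andP[_]; rewrite lt_min => /andP[].
have rd2 k : r k < k.+1%:R^-1 `^ e^-1.
  by case: (rP k) => /andP[_]; rewrite lt_min => /andP[].
have r1 k : r k < 1.
  by apply: lt_le_trans (rd1 k) _; rewrite invf_le1 ?ler1n ?ltr0n.
have re k : r k `^ e <= k.+1%:R^-1.
  apply: (@le_trans _ _ ((k.+1%:R^-1 `^ e^-1) `^ e)).
    by apply: ge0_ler_powR; rewrite ?nnegrE ?powR_ge0// ltW.
  by rewrite -powRrM mulVf ?gt_eqF// powRr1// invr_ge0.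
have /choice[B BP] k := @small_exceptional_set F (r k) t t' F0 cF
  (introT andP (conj (r0 k) (r1 k))) (proj2 (rP k)).
have mB k : measurable (B k : set (borelType G)) by case: (BP k).
pose C := @slab_const R n m * 3 ^+ m.
have C0 : 0 <= C.
  by rewrite mulr_ge0//; exact: le_trans (slab_const_ge1 n0).
have gB k : fine (gamma (B k)) <= C * k.+1%:R^-1.
  by case: (BP k) => _ h _; apply: le_trans h _; rewrite ler_wpM2l.
pose Q (j : nat) : set (borelType G) := \bigcap_(k in [set k | (j <= k)%N]) B k.
have mQ j : measurable (Q j) by apply: bigcap_measurableType => k _; exact: mB.
have Q0 j : gamma (Q j) = 0%E.
  apply/eqP; rewrite -measure_le0; apply/lee_addgt0Pr => eps eps0; rewrite add0e.
  pose k := (j + Num.truncn (C / eps))%N.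
  apply: (@le_trans _ _ (gamma (B k))).
    apply: le_measure; rewrite ?inE//.
    by move=> y; apply; exact: leq_addr.
  rewrite -[leLHS]fineK ?fin_num_measure// lee_fin (le_trans (gB k))//.
  rewrite ler_pdivrMr// mulrC -ler_pdivrMr//.
  have /andP[_ /ltW h] := @truncn_itv R (C / eps) (divr_ge0 C0 (ltW eps0)).
  by apply: le_trans h _; rewrite ler_nat ltnS leq_addl.
have : gamma.-negligible (\bigcup_j Q j).
  by apply: negligible_bigcup => j; exists (Q j); split; [exact: mQ|exact: Q0|by []].
apply: negligibleS => V nV.
apply: contrapT => nQ; apply: nV => K cK FK.
apply: le_limf_esup => eta eta0.
have [k hk nB] : exists2 k, k.+2%:R^-1 <= eta & ~ B k V.
  pose j := Num.truncn eta^-1.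
  have /existsNP[k /not_implyP[/= jk nB]] : ~ Q j V by move=> QV; apply: nQ; exists j.
  exists k => //; rewrite -[leRHS]invrK lef_pV2 ?posrE ?invr_gt0//.
  have ei : 0 <= eta^-1 by rewrite invr_ge0 ltW.
  have /andP[_ /ltW h] := truncn_itv ei.
  by apply: le_trans h _; rewrite ler_nat; lia.
exists (r k); first by rewrite r0/= (lt_le_trans (rd1 k)).
by have [_ _ h] := BP k; exact: (h V nB K cK FK).
Qed.

End LowerBound.

(** * Analytic sets and the Baire category theorem *)

Section SequentialProduct.
Context {R : realType} {n : nat}.
Local Notation Z := ('rV[R]_n * (nat -> nat))%type.
Implicit Types (z : Z) (D H : set Z) (k : nat).

Definition dyadic k : R := (2 ^+ k)^-1.

Lemma dyadic_gt0 k : 0 < dyadic k.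
Proof. by rewrite invr_gt0 exprn_gt0. Qed.

Lemma dyadicS k : dyadic k.+1 + dyadic k.+1 = dyadic k.
Proof. by rewrite /dyadic exprS invfM -mulrDl -div1r -splitr mul1r. Qed.

Lemma le_dyadic k l : (k <= l)%N -> dyadic l <= dyadic k.
Proof.
by move=> kl; rewrite lef_pV2 ?posrE ?exprn_gt0// ler_weXn2l// ler1n.
Qed.

Lemma exists_dyadic_lt (e : R) : 0 < e -> exists k, dyadic k < e.
Proof.
move=> e0; exists (Num.truncn e^-1).
have ei : 0 <= e^-1 by rewrite invr_ge0 ltW.
have /andP[_ h] := truncn_itv ei.
rewrite /dyadic -[ltRHS]invrK ltf_pV2 ?posrE ?exprn_gt0 ?invr_gt0//.
apply: lt_le_trans h _; rewrite -natrX ler_nat.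
exact: ltn_expl.
Qed.

(** The basic neighbourhoods of a point in the product of Euclidean space and the
    Baire space. *)
Definition agree k z z' : Prop :=
  `|z.1 - z'.1| <= dyadic k /\ forall i, (i < k)%N -> z.2 i = z'.2 i.

Lemma agree_refl k z : agree k z z.
Proof. by split=> //; rewrite subrr normr0 ltW// dyadic_gt0. Qed.

Lemma agree_sym k z z' : agree k z z' -> agree k z' z.
Proof. by move=> [h e]; split=> [|i ik]; [rewrite distrC|rewrite e]. Qed.

Lemma agree_le k l z z' : (k <= l)%N -> agree l z z' -> agree k z z'.
Proof.
move=> kl [h e]; split=> [|i ik]; first exact: le_trans h (le_dyadic kl).
by rewrite e// (leq_trans ik).
Qed.

Lemma agree_trans k z' z z'' : agree k.+1 z z' -> agree k.+1 z' z'' -> agree k z z''.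
Proof.
move=> [h e] [h' e']; split=> [|i ik]; last by rewrite e ?e'// leqW.
rewrite -dyadicS -[z.1 - _](subrKA z'.1).
by rewrite (le_trans (ler_normD _ _))// lerD.
Qed.

(** Closedness for the product topology. *)
Definition seq_closed D :=
  forall z, (forall k, exists2 z', D z' & agree k z z') -> D z.

Lemma seq_closed_fst (F : set 'rV[R]_n) :
  closed F -> seq_closed [set z | F z.1].
Proof.
move=> cF z hz; apply: contrapT => nF.
have : nbhs z.1 (~` F) by apply: open_nbhs_nbhs; split=> //; exact: closed_openC.
rewrite -nbhs_ballE => -[e /= e0 he].
have [k ke] := exists_dyadic_lt e0; have [z' Fz' [h _]] := hz k.
by apply: he Fz'; rewrite mx_norm_ball /ball_ /=; exact: le_lt_trans h ke.
Qed.

(** For projections of closed sets, in place of continuous images of the Baire space,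
    both countable unions and countable intersections are immediate. *)
Definition analytic (A : set 'rV[R]_n) :=
  exists2 D : set Z, seq_closed D & A = fst @` D.

Lemma analytic_closed A : closed A -> analytic A.
Proof.
move=> cA; exists [set z | A z.1]; first exact: seq_closed_fst.
apply/seteqP; split=> [x Ax|_ [z Az <-]//].
by exists (x, fun=> 0%N).
Qed.

(** The first entry of the sequence records the dyadic radius of a ball around the
    point that is contained in [A]. *)
Lemma analytic_open A : open A -> analytic A.
Proof.
move=> oA; exists [set z | forall y, `|z.1 - y| < dyadic (z.2 0%N) -> A y].
  move=> z hz y zy.
  have [k ke] : exists k, dyadic k < dyadic (z.2 0%N) - `|z.1 - y|.
    by apply: exists_dyadic_lt; rewrite subr_gt0.
  have [z' /= Az' [h e]] := hz k.+1.
  apply: Az'; rewrite -e//.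
  rewrite -[z'.1 - y](subrKA z.1) (le_lt_trans (ler_normD _ _))// -ltrBrDr.
  by rewrite distrC; apply: le_lt_trans h _; apply: le_lt_trans (le_dyadic (leqnSn k)) ke.
apply/seteqP; split=> [x Ax|_ [z Az <-]]; last first.
  by apply: Az; rewrite subrr normr0 dyadic_gt0.
have : nbhs x A by exact: open_nbhs_nbhs.
rewrite -nbhs_ballE => -[e /= e0 he].
have [k ke] := exists_dyadic_lt e0.
exists (x, fun=> k) => //= y xy; apply: he.
by rewrite mx_norm_ball /ball_ /=; exact: lt_trans xy ke.
Qed.

(** The first entry of the sequence records which set of the union contains the
    point, the others witness that it does. *)
Lemma analytic_bigcup (A : nat -> set 'rV[R]_n) :
  (forall i, analytic (A i)) -> analytic (\bigcup_i A i).
Proof.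
move=> hA; have /choice[D hD] i : exists D, seq_closed D /\ A i = fst @` D.
  by have [D ? ?] := hA i; exists D.
exists [set z | D (z.2 0%N) (z.1, fun i => z.2 i.+1)].
  move=> z hz; apply: (proj1 (hD (z.2 0%N))) => k.
  have [z' Dz' [h e]] := hz k.+1; exists (z'.1, fun i => z'.2 i.+1).
    by rewrite e.
  split=> /= [|i ik]; first exact: le_trans h (le_dyadic (leqnSn k)).
  by rewrite e.
apply/seteqP; split=> [x [i _]|_ [z Dz <-]].
  rewrite (proj2 (hD i)) => -[[y s] Ds /= <-].
  by exists (y, fun j => if j is j'.+1 then s j' else i).
by exists (z.2 0%N) => //; rewrite (proj2 (hD _)); exists (z.1, fun i => z.2 i.+1).
Qed.

(** A single sequence encodes one witness for each set, its entries being numbered by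
    pairs. *)
Lemma analytic_bigcap (A : nat -> set 'rV[R]_n) :
  (forall i, analytic (A i)) -> analytic (\bigcap_i A i).
Proof.
move=> hA; have /choice[D hD] i : exists D, seq_closed D /\ A i = fst @` D.
  by have [D ? ?] := hA i; exists D.
pose col (i : nat) (z : Z) : Z := (z.1, fun j => z.2 (pickle (i, j))).
exists [set z | forall i, D i (col i z)].
  move=> z hz i; apply: (proj1 (hD i)) => k.
  pose K := (k + \max_(j < k) (pickle (i, nat_of_ord j)).+1)%N.
  have [z' Dz' [h e]] := hz K; exists (col i z'); first exact: Dz'.
  split=> /= [|j jk]; first exact: le_trans h (le_dyadic (leq_addr _ _)).
  rewrite e// /K (leq_trans _ (leq_addl _ _))//.
  exact: (leq_bigmax (Ordinal jk)).
apply/seteqP; split=> [x Ax|_ [z Dz <-] i _].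
  have /choice[s hs] i : exists s, D i (x, s).
    by have := Ax i Logic.I; rewrite (proj2 (hD i)) => -[[y s] Ds /= <-]; exists s.
  exists (x, fun k => if unpickle k is Some p then s p.1 p.2 else 0%N) => //= i.
  rewrite /col /= (_ : (fun j => _) = s i)//.
  by apply/funext => j; rewrite pickleK.
by rewrite (proj2 (hD i)); exists (col i z).
Qed.

(** The sets that are analytic together with their complement form a sigma-algebra
    containing the open sets. *)
Lemma analytic_borel A : (@open 'rV[R]_n).-sigma.-measurable A -> analytic A.
Proof.
suff : <<s @open 'rV[R]_n >> `<=` [set A | analytic A /\ analytic (~` A)].
  by move=> h /h[].
apply: smallest_sub; last first.
  move=> B oB; split; first exact: analytic_open.
  by apply: analytic_closed; exact: open_closedC.
split.
- by split; apply: analytic_closed; [exact: closed0|rewrite setC0; exact: closedT].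
- by move=> B [aB aBC]; rewrite setTD; split=> //; rewrite setCK.
- move=> B hB; split; first by apply: analytic_bigcup => i; case: (hB i).
  by rewrite setC_bigcup; apply: analytic_bigcap => i; case: (hB i).
Qed.

(** The Baire category theorem: otherwise one chooses successively points of [D] and
    neighbourhoods of them avoiding [H 0], [H 1], and so on; the points converge to a
    point of [D] in none of the [H j]. *)
Lemma seq_closed_baire D (H : nat -> set Z) :
  seq_closed D -> D !=set0 -> (forall j, seq_closed (H j)) ->
  D `<=` \bigcup_j H j ->
  exists j z k, D z /\ forall z', D z' -> agree k z z' -> H j z'.
Proof.
move=> cD [z0 Dz0] cH DH; apply: contrapT => no.
(* The new point avoids [H j] together with a neighbourhood.  Levels increase by
   at least one, so that by [agree_trans] all later points stay in that
   neighbourhood. *)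
have step (p : nat * (Z * nat)) : exists q : Z * nat, D p.2.1 ->
    [/\ D q.1, agree p.2.2.+1 p.2.1 q.1, (p.2.2 < q.2)%N &
      forall z, agree q.2 q.1 z -> ~ H p.1 z].
  case: p => j [z k] /=; have [Dz|nDz] := pselect (D z); last by exists (z, k).
  have [z' [Dz' zz' nH]] : exists z', [/\ D z', agree k.+1 z z' & ~ H j z'].
    apply: contrapT => h; apply: no; exists j, z, k.+1; split=> // z' Dz' zz'.
    by apply: contrapT => nH; apply: h; exists z'.
  have [k' hk'] : exists k', forall z, agree k' z' z -> ~ H j z.
    apply: contrapT => h; apply: nH; apply: cH => l.
    apply: contrapT => h'; apply: h; exists l => y z'y Hy.
    by apply: h'; exists y.
  exists (z', (k + k').+1); split=> //=; first by rewrite ltnS leq_addr.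
  by move=> y z'y; apply: hk'; apply: agree_le z'y; rewrite leqW// leq_addl.
have /choice[g gP] := step.
pose fix s j : Z * nat := if j is i.+1 then g (i, s i) else (z0, 0%N).
have Ds j : D (s j).1 by elim: j => //= j /(gP (j, s j))[].
have s_agree j : agree (s j).2.+1 (s j).1 (s j.+1).1 by have [] := gP (j, s j) (Ds j).
have s_lt j : ((s j).2 < (s j.+1).2)%N by have [] := gP (j, s j) (Ds j).
have s_H j z : agree (s j.+1).2 (s j.+1).1 z -> ~ H j z.
  by have [_ _ _] := gP (j, s j) (Ds j); apply.
have s_ge j : (j <= (s j).2)%N by elim: j => // j ih; exact: leq_ltn_trans ih (s_lt j).
have s_far i d : agree (s i).2 (s i).1 (s (i + d)%N).1.
  elim: d i => [|d ih] i; first by rewrite addn0; exact: agree_refl.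
  apply: agree_trans (s_agree i) _; rewrite addnS -addSn.
  exact: agree_le (s_lt i) (ih i.+1).
have s_le i j : (i <= j)%N -> agree (s i).2 (s i).1 (s j).1.
  by move=> ij; rewrite -(subnKC ij); exact: s_far.
have : cvg ((fun j => (s j).1.1) @ \oo).
  apply: cauchy_cvg; apply: cauchy_exP => e e0.
  have [k ke] := exists_dyadic_lt e0.
  exists (s k).1.1; exists k => //= j kj.
  rewrite mx_norm_ball /ball_ /=; have [h _] := s_le k j kj.
  by apply: le_lt_trans h _; apply: le_lt_trans (le_dyadic (s_ge k)) ke.
move=> /cvg_ex[x xlim].
have x_near i : `|(s i).1.1 - x| <= dyadic (s i).2.
  apply/ler_addgt0Pr => e e0.
  have /cvg_ballP/(_ e e0)[N _ hN] := xlim.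
  have /= := hN (maxn i N) (leq_maxr _ _); rewrite mx_norm_ball /ball_ /= => xN.
  rewrite -[_ - x](subrKA (s (maxn i N)).1.1) (le_trans (ler_normD _ _))// lerD//.
    by have [] := s_le i (maxn i N) (leq_maxl _ _).
  by rewrite distrC ltW.
(* The sequence part stabilises: the point [s i.+1] already has the right entry
   at [i]. *)
pose w : Z := (x, fun i => (s i.+1).1.2 i).
have s_w i : agree (s i).2 (s i).1 w.
  split=> [|j ji]; first exact: x_near.
  rewrite /w /=; have [ij|ij] := leqP i j.+1.
    by have [_] := s_le i j.+1 ij; apply.
  have [_ e] := s_le j.+1 i (ltnW ij).
  by rewrite (e j)// (s_ge j.+1).
have Dw : D w.
  apply: cD => k; exists (s k).1; first exact: Ds.
  by apply: agree_sym; exact: agree_le (s_ge k) (s_w k).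
have [j _ Hjw] := DH w Dw.
exact: (s_H j w (s_w j.+1)).
Qed.

(** Closed boxes form a countable family; their overlap, coming from the factor 2 in
    place of 1, lets every neighbourhood contain a cell that is itself a
    neighbourhood of the same point. *)
Definition cell (c : nat * {ffun 'I_n -> int} * seq nat) : set Z :=
  [set z : Z | (forall i, `|z.1 0 i - (c.1.2 i)%:~R * dyadic c.1.1| <= 2 * dyadic c.1.1)
    /\ forall i, (i < c.1.1)%N -> z.2 i = nth 0%N c.2 i].

Lemma exists_cell z k :
  exists c, (forall z', agree k.+3 z z' -> cell c z') /\
            (forall z', cell c z' -> agree k z z').
Proof.
pose q := dyadic k.+3; have q0 : 0 < q := dyadic_gt0 _.
pose a : {ffun 'I_n -> int} := [ffun i => Num.floor (z.1 0 i / q)].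
have za i : `|z.1 0 i - (a i)%:~R * q| <= q.
  have /andP[h1 h2] := real_floor_itv (num_real (z.1 0 i / q)).
  rewrite /a ffunE; move: h1 h2.
  rewrite ler_pdivlMr// ltr_pdivrMr// intrD mulrDl mul1r => h1 h2.
  by rewrite ger0_norm; lra.
exists (k.+3, a, mkseq z.2 k.+3); split=> z' [h e]; split=> /=.
- move=> i; rewrite -/q; apply: (@le_trans _ _ (q + q)); last lra.
  rewrite -[_ - _ * q](subrKA (z.1 0 i)) (le_trans (ler_normD _ _))// lerD//.
  apply: le_trans h; rewrite distrC.
  by have := coord_le_mx_norm (z.1 - z'.1) i; rewrite !mxE.
- by move=> i ik; rewrite nth_mkseq// e.
- rewrite [`|_|]mx_normrE; apply: bigmax_le => [|[i0 i] _]; first exact/ltW/dyadic_gt0.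
  rewrite ord1 /= !mxE; have := za i; have := h i; rewrite /= -/q => h1 h2.
  have <- : q + q + (q + q) + (q + q + (q + q)) = dyadic k by rewrite /q !dyadicS.
  rewrite -[_ - z'.1 0 i](subrKA ((a i)%:~R * q)) (le_trans (ler_normD _ _))//.
  rewrite (distrC _ (z'.1 0 i)); lra.
- by move=> i ik; rewrite e ?nth_mkseq//= ltnW// ltnW// ltnW.
Qed.

End SequentialProduct.

(** * Packing dimensions of projections *)

Section PackingDimension.
Context {R : realType} {n : nat}.
Implicit Types (A B E F : set 'rV[R]_n) (t : R).

Lemma upper_box_dim_ge0 F : (0 < n)%N -> F !=set0 -> compact F ->
  (0%:E <= upper_box_dim F)%E.
Proof.
move=> n0 F0 cF; apply: le_limf_esup => d d0.
exists (Num.min (d / 2) (1 / 2)).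
  rewrite lt_min !divr_gt0//= gt_min; apply/orP; left.
  by rewrite ltr_pdivrMr// ltr_pMr// ltr1n.
set r := Num.min _ _.
have r0 : 0 < r by rewrite lt_min !divr_gt0.
have r1 : r < 1.
  by rewrite gt_min; apply/orP; right; rewrite ltr_pdivrMr// mul1r ltr1n.
rewrite divr_ge0//; first by rewrite ln_ge0// covering_number_ge1.
by rewrite oppr_ge0 ln_le0// ltW.
Qed.

Lemma packing_dim_ge0 E : (0 < n)%N -> (0%:E <= packing_dim E)%E.
Proof.
move=> n0; apply: le_ereal_inf_tmp => _ [F [Fc _] <-].
have [F0 cF] := Fc 0%N; apply: le_trans (upper_box_dim_ge0 n0 F0 cF) _.
by apply: ereal_sup_ubound; exists 0%N.
Qed.

Variable m : nat.

(** All weights sit at one point, where the kernel is 1, so that every discrete energy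
    equals 1. *)
Lemma upper_box_dim_profile_set1 (x : 'rV[R]_n) :
  (upper_box_dim_profile m%:R [set x] <= 0)%E.
Proof.
apply/lee_addgt0Pr => e e0; rewrite add0e leNgt; apply/negP => he.
have T1 : 0 < (3 ^+ m)^-1 :> R by rewrite invr_gt0 exprn_gt0.
pose d : R := Num.min 1 ((3 ^+ m)^-1 `^ e^-1).
have d0 : 0 < d by rewrite lt_min ltr01 powR_gt0.
have [r /andP[r0 rd] hr] := limf_esup_gt he d0.
have r1 : r < 1 by move: rd; rewrite lt_min => /andP[].
have rT : r < (3 ^+ m)^-1 `^ e^-1 by move: rd; rewrite lt_min => /andP[].
have r01 : 0 < r < 1 by rewrite r0.
have [|N [y [w [yx w0 w1 hE]]]] :=
  capacity_exponent_gt _ (@compact_set1 _ x) r01 hr; first by exists x.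
have : 1 <= 3 ^+ m * r `^ e.
  apply: le_trans hE.
  rewrite (eq_bigr (fun i => w i)) ?w1// => i _.
  rewrite (eq_bigr (fun j => w i * w j)) => [|j _].
    by rewrite -mulr_sumr w1 mulr1.
  by rewrite (yx i) (yx j) subrr /phi eqxx mulr1.
apply/negP; rewrite -ltNge -ltr_pdivlMl ?exprn_gt0// mulr1.
apply: (@lt_le_trans _ _ (((3 ^+ m)^-1 `^ e^-1) `^ e)).
  by apply: gt0_ltr_powR; rewrite ?nnegrE ?powR_ge0// ltW.
by rewrite -powRrM mulVf ?gt_eqF// powRr1// ltW.
Qed.

Definition profile_le t A : Prop := (packing_dim_profile m%:R A <= t%:E)%E.

Lemma profile_le_set0 t : 0 <= t -> profile_le t set0.
Proof.
move=> t0; apply: ge_ereal_inf; eexists.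
  exists (fun=> [set 0]) => //; split=> // i.
  by split; [exists 0|exact: compact_set1].
apply: ge_ereal_sup => _ [i _ <-].
by apply: le_trans (upper_box_dim_profile_set1 0) _; rewrite lee_fin.
Qed.

Lemma profile_le_sub t A B : A `<=` B -> profile_le t B -> profile_le t A.
Proof.
move=> AB; apply: le_trans; apply: ereal_inf_le_tmp => _ [F [Fc BF] <-].
by exists F => //; split=> //; exact: subset_trans BF.
Qed.

(** Countable stability: covers of the pieces with a small loss are merged into one
    cover. *)
Lemma profile_le_bigcup t (A : nat -> set 'rV[R]_n) :
  (forall i, profile_le t (A i)) -> profile_le t (\bigcup_i A i).
Proof.
move=> hA; apply/lee_addgt0Pr => e e0.
have /choice[F FP] i : exists F : nat -> set 'rV[R]_n, Defs.compact_cover (A i) F /\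
    (ereal_sup (range (fun j => upper_box_dim_profile m%:R (F j))) <= t%:E + e%:E)%E.
  have : (packing_dim_profile m%:R (A i) < t%:E + e%:E)%E.
    by apply: le_lt_trans (hA i) _; rewrite lteDl// lte_fin.
  by move=> /ereal_inf_lt[_ [F Fc <-]] /ltW h; exists F.
pose p k : nat * nat := if unpickle k is Some q then q else (0%N, 0%N).
apply: ge_ereal_inf; eexists.
  exists (fun k => F (p k).1 (p k).2) => //; split.
    by move=> k; have [[h _] _] := FP (p k).1; exact: h.
  move=> x [i _ Aix]; have [[_ h] _] := FP i; have [j _ Fx] := h x Aix.
  by exists (pickle (i, j)) => //; rewrite /p pickleK.
apply: ge_ereal_sup => _ [k _ <-].
have [_ h] := FP (p k).1; apply: le_trans h.
by apply: ereal_sup_ubound; exists (p k).2.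
Qed.

Lemma compact_eball (c : 'rV[R]_n) (rho : R) :
  compact [set y | enorm (y - c) <= rho].
Proof.
apply: bounded_closed_compact.
  exists (rho + `|c|); split; first exact: num_real.
  move=> M hM y /= yc; apply: le_trans _ (ltW hM).
  rewrite -[y](subrK c) (le_trans (ler_normD _ _))// lerD2r.
  exact: le_trans (mx_norm_le_enorm _) yc.
rewrite (_ : [set y | _] = (fun y => enorm (y - c)) @^-1` [set a | a <= rho])//.
by apply: closed_comp; [move=> y _; exact: dist_continuous|exact: closed_le].
Qed.

(** A bounded set is covered by its closure alone. *)
Lemma profile_gt_closure t A (c : 'rV[R]_n) (rho : R) :
  0 <= t -> ~ profile_le t A -> (forall x, A x -> enorm (x - c) <= rho) ->
  [/\ closure A !=set0, compact (closure A) &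
     (t%:E < upper_box_dim_profile m%:R (closure A))%E].
Proof.
move=> t0 nA bA.
have A0 : closure A !=set0.
  have [A0|/set0P[x Ax]] := eqVneq A set0.
    by case: nA; rewrite A0; exact: profile_le_set0.
  by exists x; exact: subset_closure.
have cA : compact (closure A).
  apply: (subclosed_compact (@closed_closure _ A) (@compact_eball c rho)).
  have := compact_rV_closed (@compact_eball c rho) => /closure_id ->.
  by apply: closure_subset => x /bA.
split=> //; rewrite ltNge; apply/negP => h; apply: nA.
apply: ge_ereal_inf; eexists.
  exists (fun=> closure A) => //; split=> // x Ax.
  by exists 0%N => //; exact: subset_closure.
by apply: ge_ereal_sup => _ [i _ <-].
Qed.

End PackingDimension.

Section Kernel.
Context {R : realType} {n m : nat}.
Local Notation Z := ('rV[R]_n * (nat -> nat))%type.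
Implicit Types (D S : set Z) (t : R).

(** The analogue of the perfect kernel of Cantor and Bendixson, with a small profile
    of the projection in the place of countability. *)
Definition kernel t D : set Z :=
  [set z | D z /\ forall k, ~ profile_le m t (fst @` (D `&` agree k z))].

Lemma kernel_closed t D : seq_closed D -> seq_closed (kernel t D).
Proof.
move=> cD z hz; split=> [|k hk].
  by apply: cD => k; have [z' [Dz' _] zz'] := hz k; exists z'.
have [z' [Dz' /(_ k.+1) nz'] zz'] := hz k.+1.
apply: nz'; apply: profile_le_sub hk; apply: image_subset => y [Dy z'y].
by split=> //; exact: agree_trans zz' z'y.
Qed.

(** The points removed from [D] lie in countably many cells with small profile, and
    small profiles are stable under countable unions. *)
Lemma profile_le_kernel t D S : S `<=` D ->
  profile_le m t (fst @` (S `&` kernel t D)) -> profile_le m t (fst @` S).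
Proof.
move=> SD hS.
pose bad c := profile_le m t (fst @` (D `&` @cell R n c)).
pose A (j : nat) : set 'rV[R]_n :=
  if unpickle j is Some c then
    if `[< bad c >] then fst @` (D `&` cell c) else set0
  else fst @` (S `&` kernel t D).
have hA j : profile_le m t (A j).
  rewrite /A; case: (unpickle j) => // c; case: asboolP => // _.
  by apply: profile_le_sub hS; exact: sub0set.
(* The cells that are removed, indexed by their codes, together with the rest of
   [S]. *)
pose A' j := if j is i.+1 then A i else fst @` (S `&` kernel t D).
have hA' j : profile_le m t (A' j) by case: j => /=.
apply: profile_le_sub (profile_le_bigcup hA') => _ [z Sz <-].
have [kz|nkz] := pselect (kernel t D z); first by exists 0%N => //; exists z.
have [k hk] : exists k, profile_le m t (fst @` (D `&` agree k z)).
  apply: contrapT => h; apply: nkz; split; first exact: SD.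
  by move=> k hk; apply: h; exists k.
have [c [zc cz]] := exists_cell z k.
have bc : bad c.
  by apply: profile_le_sub hk; apply: image_subset => y [Dy /cz].
exists (pickle c).+1 => //=; rewrite /A pickleK asboolT//.
by exists z => //; split; [exact: SD|exact/zc/agree_refl].
Qed.

End Kernel.

Section LowerBound.
Context {R : realType} {n m : nat} {le_mn : (m <= n)%N}.
Local Notation G := (Grassmannian R le_mn).
Local Notation Z := ('rV[R]_n * (nat -> nat))%type.
Variable gamma : probability (borelType G) R.
Hypotheses (gammaP : orthogonally_invariant gamma) (n0 : (0 < n)%N).

Lemma cell_bounded c (z : Z) : cell c z ->
  enorm (z.1 - \row_i ((c.1.2 i)%:~R * dyadic c.1.1)) <= n%:R * (2 * dyadic c.1.1).
Proof.
move=> [h _]; apply: enorm_le_coord => [|i].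
  by rewrite mulr_ge0// ltW// dyadic_gt0.
by rewrite !mxE.
Qed.

(** Write [E] as the projection of a closed set [D] and let [D'] be its kernel.  Each
    of the countably many cells meeting [D'] in a set of large profile has, for almost
    every [V], a projection of large upper box dimension, and so has every compact set
    containing that projection.  If now compact sets [K j] cover the projection of
    [E], then by the Baire category theorem one of them contains the projection of a
    whole neighbourhood in [D'], hence of such a cell. *)
Lemma ae_packing_dim_orthproj_ge (E : set 'rV[R]_n) (t : R) :
  (@open 'rV[R]_n).-sigma.-measurable E -> 0 <= t ->
  (t%:E < packing_dim_profile m%:R E)%E ->
  {ae gamma, forall V : G, (t%:E <= packing_dim (orthproj V @` E))%E}.
Proof.
move=> /analytic_borel[D cD DE] t0 tE.
have nE : ~ profile_le m t (fst @` D).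
  by rewrite -DE /profile_le leNgt tE.
pose D' := kernel (m := m) t D.
have D'D : D' `<=` D by move=> z [].
(* The kernel carries the profile of every part of [D]. *)
have local S : S `<=` D -> ~ profile_le m t (fst @` S) ->
    ~ profile_le m t (fst @` (S `&` D')).
  by move=> SD nS h; apply: nS; exact: profile_le_kernel SD h.
have D'0 : D' !=set0.
  apply/set0P/eqP => D'0; apply: (local D (@subset_refl _ D) nE).
  by rewrite D'0 setI0 image_set0; exact: profile_le_set0.
pose A c : set 'rV[R]_n := fst @` (D' `&` cell c).
pose good c (V : G) := ~ profile_le m t (A c) ->
  forall K, compact K -> orthproj V @` closure (A c) `<=` K ->
    (t%:E <= upper_box_dim K)%E.
have aegood c : {ae gamma, forall V, good c V}.
  have [hc|nc] := pselect (profile_le m t (A c)).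
    by apply: aeW => V /(_ hc).
  have bc x : A c x ->
      enorm (x - \row_i ((c.1.2 i)%:~R * dyadic c.1.1)) <= n%:R * (2 * dyadic c.1.1).
    by move=> [z [_ cz] <-]; exact: cell_bounded.
  have [F0 cF tF] := profile_gt_closure t0 nc bc.
  have := ae_upper_box_dim_orthproj_ge n0 gammaP F0 cF tF.
  by apply: negligibleS => V nV h; apply: nV => _; exact: h.
have : {ae gamma, forall V, forall j, if unpickle j is Some c then good c V else True}.
  apply: ae_foralln => j; case: (unpickle j) => [c|]; first exact: aegood.
  exact: aeW.
apply: negligibleS => V nV allgood; apply: nV.
apply: le_ereal_inf_tmp => _ [K [Kc EK] <-].
pose H j : set Z := [set z | (orthproj V @^-1` K j) z.1].
have cK j : closed (orthproj V @^-1` K j).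
  apply: closed_comp; first by move=> x _; exact: orthproj_continuous.
  by apply: compact_rV_closed; case: (Kc j).
have D'H : D' `<=` \bigcup_j H j.
  move=> z /D'D Dz; have [|j _ Kz] := EK (orthproj V z.1).
    by exists z.1 => //; rewrite DE; exists z.
  by exists j.
have [j [z [k [D'z zH]]]] := seq_closed_baire (kernel_closed cD) D'0
  (fun j => seq_closed_fst (cK j)) D'H.
have [c [zc cz]] := exists_cell z k.
have nc : ~ profile_le m t (A c).
  have [Dz /(_ k.+3) nz] := D'z.
  have := local (D `&` agree k.+3 z) (@subIsetl _ _ _) nz; apply: contra_not.
  apply: profile_le_sub; apply: image_subset => y [[_ /zc cy] D'y].
  by split.
have := allgood (pickle c); rewrite pickleK => /(_ nc (K j) (proj2 (Kc j))) h.
apply: (le_trans (h _)); last by apply: ereal_sup_ubound; exists j.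
move=> _ [x Ax <-].
have AK : A c `<=` orthproj V @^-1` K j.
  by move=> _ [y [D'y /cz zy] <-]; exact: zH zy.
have := closure_subset AK Ax.
by rewrite -(proj1 (closure_id _) (cK j)).
Qed.

End LowerBound.

Theorem theorem3p5 (R : realType) (n m : nat)
    (m_ge1 : (1 <= m)%N) (m_le : (m <= n - 1)%N)
    (E : set 'rV[R]_n) (E_borel : (@open 'rV[R]_n).-sigma.-measurable E) :
  let G := Grassmannian R (leq_trans m_le (leq_subr 1 n)) in
  (forall V : G,
    (packing_dim (orthproj V @` E) <= packing_dim_profile m%:R E)%E) /\
  (forall gamma : probability (borelType G) R, orthogonally_invariant gamma ->
    {ae gamma, forall V : G,
      (packing_dim (orthproj V @` E) >= packing_dim_profile m%:R E)%E}).
Proof.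
move=> G; split=> [V|gamma gammaP]; first exact: packing_dim_orthproj_le.
have n0 : (0 < n)%N by apply: leq_trans m_ge1 (leq_trans m_le (leq_subr 1 n)).
(* Exceptional sets for countably many exponents may be united, and rational
   exponents suffice to compare the two dimensions. *)
pose above (q : rat) (V : G) := 0 <= (ratr q : R) ->
  ((ratr q)%:E < packing_dim_profile m%:R E)%E ->
  ((ratr q)%:E <= packing_dim (orthproj V @` E))%E.
have aeabove q : {ae gamma, forall V, above q V}.
  have [q0|nq0] := pselect (0 <= (ratr q : R)); last by apply: aeW => V /nq0.
  have [qE|nqE] := pselect ((ratr q)%:E < packing_dim_profile m%:R E)%E; last first.
    by apply: aeW => V _ /nqE.
  have := ae_packing_dim_orthproj_ge gammaP n0 E_borel q0 qE.
  by apply: negligibleS => V nV h; apply: nV.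
have : {ae gamma, forall V, forall j, if unpickle j is Some q then above q V else True}.
  apply: ae_foralln => j; case: (unpickle j) => [q|]; first exact: aeabove.
  exact: aeW.
apply: negligibleS => V nV allabove; apply: nV.
have abv q : above q V by have := allabove (pickle q); rewrite pickleK.
have [//|lt] := leP (packing_dim_profile m%:R E) (packing_dim (orthproj V @` E)).
exfalso.
have [a [b [a0 ab pa bE]]] : exists a b : R, [/\ 0 <= a, a < b,
    (packing_dim (orthproj V @` E) <= a%:E)%E & (b%:E <= packing_dim_profile m%:R E)%E].
  have := packing_dim_ge0 (orthproj V @` E) n0; move: lt.
  case: (packing_dim _) => [a||]//; case: (packing_dim_profile _ _) => [b||]//.
    by rewrite !lte_fin lee_fin => ab a0; exists a, b.
  by rewrite lee_fin => _ a0; exists a, (a + 1); rewrite leey ltrDl ltr01.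
have [q] := rat_in_itvoo ab; rewrite in_itv/= => /andP[aq qb].
have : ((ratr q)%:E <= a%:E)%E.
  apply: le_trans pa; apply: abv; first exact: le_trans a0 (ltW aq).
  by apply: lt_le_trans bE; rewrite lte_fin.
by rewrite lee_fin leNgt aq.
Qed.
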